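(* Let $B\subseteq\mathbb R^q$ be a contractible open set and $M^*:=B\times(T^r)^*$. Let $\mathcal A_0$ denote the space of Hermitian connections on the trivial complex line bundle $L^*=M^*\times\mathbb C\to M^*$ and $\mathcal G_U=C^\infty(M^*,S^1)$ the unitary gauge group. The map $$\{\text{graphical submanifolds of }B\times T^r\}\cong C^\infty(B,T^r)\longrightarrow\mathcal A_0/\mathcal G_U,\qquad \mathrm{graph}\,u\longmapsto[\nabla_u],$$ where $\mathrm{graph}\,u:=\{(x,u(x))\mid x\in B\}$, is injective. Moreover, its image is precisely the subset of $\mathcal A_0/\mathcal G_U$ consisting of those gauge-equivalence classes $[\nabla]$ for which there exists a representative $\nabla'\in[\nabla]$ satisfying $$t\cdot\nabla'=\nabla'\quad\text{for all }t\in(T^r)^*,\qquad D_B^{\nabla'}=d_B .$$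
   Context: $T^r=\mathbb R^r/2\pi\mathbb Z^r$ and $(T^r)^*=(\mathbb R^r)^*/(\mathbb Z^r)^*$, with coordinates $(y^{q+1},\dots,y^{q+r})$ of period $1$ on $(T^r)^*$ induced by the dual basis of $(\mathbb{R}^r)^*$; $(x^1,\dots,x^q)$ are coordinates on $B$. $L^*$ has the standard Hermitian metric. Given a smooth $u:B\to T^r$, choose a lift $B\to\mathbb R^r$ with components $u^{q+1},\dots,u^{q+r}$; its real Fourier–Mukai transform is $\nabla_u:=d+\sqrt{-1}\sum_{a=q+1}^{q+r}u^a(x)\,dy^a$ on $L^*$. Its class $[\nabla_u]\in\mathcal A_0/\mathcal G_U$ does not depend on the lift. The gauge action is $g\cdot\nabla=g^{-1}\circ\nabla\circ g=\nabla+g^{-1}dg$ for $g\in\mathcal G_U$. The dual torus action of $t\in(T^r)^*$ on $\mathcal A_0$: if $\nabla=d+\sqrt{-1}\big(\sum_{i=1}^q a_i(x,y)dx^i+\sum_{a=q+1}^{q+r} b_a(x,y)dy^a\big)$ with real functions $a_i$, $b_a$ on $M^*$, then $t\cdot\nabla=d+\sqrt{-1}\big(\sum_i a_i(x,y+t)dx^i+\sum_a b_a(x,y+t)dy^a\big)$. The $B$-direction partial connection $D_B^\nabla$ is the restriction of $\nabla$ to $F_B:=\ker(d\pi_{(T^r)^*})\subseteq TM^*$, where $\pi_{(T^r)^*}:M^*\to(T^r)^*$ is the projection; for $\nabla=d+\sqrt{-1}\big(\sum_{i=1}^q a_i(x,y)dx^i+\sum_{a=q+1}^{q+r} b_a(x,y)dy^a\big)$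 with real functions $a_i$, $b_a$ on $M^*$, $D_B^\nabla=d_B+\sqrt{-1}\sum_i a_i\,dx^i$, where $d_B$ is the trivial partial connection along $F_B$. *)

(* Defs.v *)
From HB Require Import structures.
From mathcomp Require Import all_boot all_order all_algebra.
From mathcomp Require Import generic_quotient ring_quotient.
From mathcomp Require Import all_classical all_reals all_analysis.
From mathcomp.real_closed Require Import complex.

Set Implicit Arguments.
Unset Strict Implicit.
Unset Printing Implicit Defensive.

Import Order.TTheory GRing.Theory Num.Theory numFieldNormedType.Exports.

Local Open Scope classical_set_scope.
Local Open Scope ring_scope.
Local Open Scope quotient_scope.

Section Smooth.
Context {R : realType} {n : nat}.
Implicit Types (f g : 'rV[R]_n -> R) (x : 'rV[R]_n).

Definition pderiv (j : 'I_n) f : 'rV[R]_n -> R :=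
  fun x => 'D_(delta_mx 0 j) f x.

(* f is of class C^k on some neighbourhood of x *)
Fixpoint Ck_at (k : nat) f x : Prop :=
  (\forall y \near x, {for y, continuous f}) /\
  if k is k'.+1 then
    (forall j, \forall y \near x, derivable f y (delta_mx 0 j)) /\
    (forall j, Ck_at k' (pderiv j f) x)
  else True.

Definition smooth_at f x : Prop := forall k, Ck_at k f x.

Lemma near_eq_pderiv j f g x : (\forall y \near x, f y = g y) ->
  \forall y \near x, pderiv j f y = pderiv j g y.
Proof.
by move/near_join; apply: filterS => y; exact: near_eq_derive.
Qed.

Lemma near_eq_continuous f g x : (\forall y \near x, f y = g y) ->
  (\forall y \near x, {for y, continuous f}) ->
  \forall y \near x, {for y, continuous g}.
Proof.
move=> /near_join; apply: filterS2 => y fg cf.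
move: cf; rewrite /prop_for /continuous_at -(nbhs_singleton fg).
by apply: cvg_trans; apply: (@near_eq_cvg _ _ (nbhs (y : 'rV[R]_n))).
Qed.

Lemma near_eq_Ck_at k f g x : (\forall y \near x, f y = g y) ->
  Ck_at k f x -> Ck_at k g x.
Proof.
elim: k f g => [|k IH] f g fg /= [cf H].
  by split=> //; exact: near_eq_continuous cf.
case: H => df pf; split; first exact: near_eq_continuous cf.
split=> j; last exact: IH (near_eq_pderiv j fg) (pf j).
move/near_join: fg (df j); apply: filterS2 => y fg.
exact: near_eq_derivable.
Qed.

Lemma Ck_atW k f x : Ck_at k.+1 f x -> Ck_at k f x.
Proof.
elim: k f => [|k IH] f /= [cf [df pf]]; split=> //.
by split=> // j; apply/IH/pf.
Qed.

Lemma Ck_atD k f g x : Ck_at k f x -> Ck_at k g x -> Ck_at k (f \+ g) x.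
Proof.
elim: k f g => [|k IH] f g /= [cf df] [cg dg].
  by split=> //; move: cf cg; apply: filterS2 => y; exact: continuousD.
case: df dg => [df pf] [dg pg]; split.
  by move: cf cg; apply: filterS2 => y; exact: continuousD.
split=> j; first by move: (df j) (dg j); apply: filterS2 => y; exact: derivableD.
apply: near_eq_Ck_at (IH _ _ (pf j) (pg j)).
by move: (df j) (dg j); apply: filterS2 => y ? ?; rewrite /pderiv /= deriveD.
Qed.

Lemma Ck_atM k f g x : Ck_at k f x -> Ck_at k g x -> Ck_at k (f \* g) x.
Proof.
elim: k f g => [|k IH] f g /=; first move=> [cf df] [cg dg].
  by split=> //; move: cf cg; apply: filterS2 => y; exact: continuousM.
move=> Hf Hg; have [[cf [df pf]] [cg [dg pg]]] := (Hf, Hg); split.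
  by move: cf cg; apply: filterS2 => y; exact: continuousM.
split=> j; first by move: (df j) (dg j); apply: filterS2 => y; exact: derivableM.
apply: near_eq_Ck_at
  (Ck_atD (IH _ _ (Ck_atW Hf) (pg j)) (IH _ _ (Ck_atW Hg) (pf j))).
move: (df j) (dg j); apply: filterS2 => y ? ?.
by rewrite /pderiv /= deriveM.
Qed.

Lemma Ck_at_cst k (c : R) x : Ck_at k (cst c) x.
Proof.
have xF : Filter (nbhs x) := _.
elim: k c => [|k IH] c /=.
  by split=> //; apply: (@nearW _ (nbhs x)) => y; exact: cst_continuous.
split; first by apply: (@nearW _ (nbhs x)) => y; exact: cst_continuous.
split=> j; first by apply: (@nearW _ (nbhs x)) => y; exact: derivable_cst.
apply: near_eq_Ck_at (IH 0); apply: (@nearW _ (nbhs x)) => y.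
by rewrite /pderiv derive_cst.
Qed.

End Smooth.

(* Contractible in the subspace topology; in particular nonempty. *)
Definition contractible_set (R : realType) (n : nat) (A : set 'rV[R]_n) : Prop :=
  exists (x0 : 'rV[R]_n) (H : R * 'rV[R]_n -> 'rV[R]_n),
    [/\ A x0,
        {within `[0, 1]%classic `*` A, continuous H},
        (forall s x, 0 <= s <= 1 -> A x -> A (H (s, x))),
        (forall x, A x -> H (0, x) = x) &
        (forall x, A x -> H (1, x) = x0)].

Definition lattice (R : realType) (c : R) (n : nat) : {pred 'rV[R]_n} :=
  fun v => `[< exists m : 'rV[int]_n, v = c *: map_mx intr m >].

Lemma lattice_zmod_closed (R : realType) (c : R) n :
  zmod_closed (lattice c (n := n)).
Proof.
split=> [|v w /asboolP [k ->] /asboolP [m ->]]; apply/asboolP.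
  by exists 0; rewrite map_mx0 scaler0.
by exists (k - m); rewrite map_mxB scalerBr.
Qed.

HB.instance Definition _ (R : realType) (c : R) n :=
  GRing.isZmodClosed.Build 'rV[R]_n (@lattice R c n) (lattice_zmod_closed c n).

Notation quotient_torus R c n := (Quotient.quot (@lattice R c n)).

Definition torus (R : realType) (r : nat) := quotient_torus R (2 * pi) r.

(* Row vectors stand for covectors written in the dual basis of (R^r)^*, so
   that the dual lattice is Z^r and the coordinates y have period 1. *)
Definition dual_torus (R : realType) (r : nat) := quotient_torus R 1 r.

HB.instance Definition _ R r := GRing.Zmodule.on (torus R r).
HB.instance Definition _ R r := GRing.Zmodule.on (dual_torus R r).

Definition torus_pi {R : realType} {r : nat} (v : 'rV[R]_r) : torus R r :=
  \pi_(quotient_torus R (2 * pi) r) v.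

Definition dual_torus_pi {R : realType} {r : nat} (v : 'rV[R]_r) :
  dual_torus R r := \pi_(quotient_torus R 1 r) v.

Section Base.
Context {R : realType} {q r : nat} {B : set 'rV[R]_q}.

Definition base_smooth (f : B -> R) : Prop :=
  forall x : B, smooth_at (fun y => oapp f 0 (insub y)) (val x).

(* u is smooth when it is locally the projection of a smooth R^r-valued map *)
Definition torus_smooth (u : B -> torus R r) : Prop :=
  forall x : B, exists f : 'rV[R]_q -> 'rV[R]_r,
    \forall y \near val x,
      (forall a, smooth_at (fun z => f z 0 a) y) /\
      (forall b : B, val b = y -> u b = torus_pi (f y)).

Definition is_lift (u : B -> torus R r) (f : B -> 'rV[R]_r) : Prop :=
  (forall a, base_smooth (fun x => f x 0 a)) /\
  (forall x, torus_pi (f x) = u x).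

(* On a contractible B a smooth u has lifts, so the default is not reached. *)
Definition lift_of (u : B -> torus R r) : B -> 'rV[R]_r :=
  xget (fun _ => 0) [set f | is_lift u f].

Definition graph (u : B -> torus R r) : set (B * torus R r) :=
  [set p | p.2 = u p.1].

Definition graphical : set (set (B * torus R r)) :=
  [set graph u | u in torus_smooth].

Definition graph_map (S : set (B * torus R r)) : B -> torus R r :=
  fun x => xget 0 [set y | S (x, y)].

Lemma graphK u : graph_map (graph u) = u.
Proof. by apply/funext => x; apply: xget_unique. Qed.

End Base.

Arguments graphical {R q} r B.

Definition mirror (R : realType) (q r : nat) (B : set 'rV[R]_q) : Type :=
  (B * dual_torus R r)%type.

Section Mirror.
Context {R : realType} {q r : nat} {B : set 'rV[R]_q}.
Local Notation M := (mirror r B).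
Local Notation C := R[i].

(* The function induced on B x R^r, periodic in the last r variables, and
   extended by 0 outside of B x R^r. *)
Definition unroll (f : M -> R) : 'rV[R]_(q + r) -> R :=
  fun z => oapp (fun x : B => f (x, dual_torus_pi (rsubmx z))) 0
                (insub (lsubmx z)).

Definition msmooth (f : M -> R) : Prop :=
  forall z, B (lsubmx z) -> smooth_at (unroll f) z.

(* Partial derivative with respect to x^j (j < q) or y^j (q <= j < q + r);
   by periodicity it does not depend on the representative of p.2. *)
Definition mpartial (j : 'I_(q + r)) (f : M -> R) : M -> R :=
  fun p => pderiv j (unroll f) (row_mx (val p.1) (repr p.2)).

Definition csmooth (s : M -> C) : Prop :=
  msmooth (fun p => complex.Re (s p)) /\ msmooth (fun p => complex.Im (s p)).

Definition cpartial (j : 'I_(q + r)) (s : M -> C) : M -> C :=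
  fun p => Complex (mpartial j (fun p => complex.Re (s p)) p)
                   (mpartial j (fun p => complex.Im (s p)) p).

(* C^oo(M^*, C), which is also the space of sections of L^* *)
Record smooth_fun := SmoothFun {
  smooth_fun_val :> M -> C;
  smooth_funP : csmooth smooth_fun_val
}.

Lemma smooth_fun_eq (s t : smooth_fun) : (forall p, s p = t p) -> s = t.
Proof.
case: s t => [s Hs] [t Ht] /= /funext st.
by subst t; congr SmoothFun; exact: Prop_irrelevance.
Qed.

Lemma msmoothD f g : msmooth f -> msmooth g -> msmooth (fun p => f p + g p).
Proof.
move=> Hf Hg z Bz k.
rewrite [unroll _](_ : _ = unroll f \+ unroll g).
  by apply: Ck_atD; [exact: Hf|exact: Hg].
by apply/funext => w; rewrite /unroll /=; case: insub => //=; rewrite addr0.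
Qed.

Lemma msmoothM f g : msmooth f -> msmooth g -> msmooth (fun p => f p * g p).
Proof.
move=> Hf Hg z Bz k.
rewrite [unroll _](_ : _ = unroll f \* unroll g).
  by apply: Ck_atM; [exact: Hf|exact: Hg].
by apply/funext => w; rewrite /unroll /=; case: insub => //=; rewrite mulr0.
Qed.

Lemma msmoothN f : msmooth f -> msmooth (fun p => - f p).
Proof.
move=> Hf z Bz k.
rewrite [unroll _](_ : _ = cst (-1) \* unroll f).
  by apply: Ck_atM; [exact: Ck_at_cst|exact: Hf].
by apply/funext => w; rewrite /unroll /= mulN1r; case: insub => //=; rewrite oppr0.
Qed.

Lemma csmoothD (s t : M -> C) :
  csmooth s -> csmooth t -> csmooth (fun p => s p + t p).
Proof.
move=> [s1 s2] [t1 t2]; split.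
  rewrite [X in msmooth X](_ : _ =
    (fun p => complex.Re (s p) + complex.Re (t p))); first exact: msmoothD.
  by apply/funext => p; case: (s p) => ? ?; case: (t p).
rewrite [X in msmooth X](_ : _ =
  (fun p => complex.Im (s p) + complex.Im (t p))); first exact: msmoothD.
by apply/funext => p; case: (s p) => ? ?; case: (t p).
Qed.

Lemma csmoothM (s t : M -> C) :
  csmooth s -> csmooth t -> csmooth (fun p => s p * t p).
Proof.
move=> [s1 s2] [t1 t2]; split.
  rewrite [X in msmooth X](_ : _ = (fun p =>
    complex.Re (s p) * complex.Re (t p) +
    - (complex.Im (s p) * complex.Im (t p)))).
    by apply: msmoothD; [exact: msmoothM|apply: msmoothN; exact: msmoothM].
  by apply/funext => p; case: (s p) => ? ?; case: (t p).
rewrite [X in msmooth X](_ : _ = (fun p =>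
  complex.Re (s p) * complex.Im (t p) + complex.Im (s p) * complex.Re (t p))).
  by apply: msmoothD; exact: msmoothM.
by apply/funext => p; case: (s p) => ? ?; case: (t p).
Qed.

Definition add_fun (s t : smooth_fun) : smooth_fun :=
  SmoothFun (csmoothD (smooth_funP s) (smooth_funP t)).

Definition mul_fun (s t : smooth_fun) : smooth_fun :=
  SmoothFun (csmoothM (smooth_funP s) (smooth_funP t)).

(* D s j is the covariant derivative of s along the j-th coordinate field of
   the global frame (d/dx^1, .., d/dx^q, d/dy^(q+1), .., d/dy^(q+r)). *)
Definition operator := smooth_fun -> 'I_(q + r) -> M -> C.

(* Homogeneity over C is the Leibniz rule for constant f. *)
Record hermitian_connection (D : operator) : Prop := {
  conn_smooth : forall s j, csmooth (D s j);
  conn_add : forall s t j p, D (add_fun s t) j p = D s j p + D t j p;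
  conn_leibniz : forall f s j p,
    D (mul_fun f s) j p = cpartial j f p * s p + f p * D s j p;
  conn_metric : forall (s t : smooth_fun) j p,
    cpartial j (fun p => (s p : C) * (t p : C)^*) p =
      D s j p * (t p : C)^* + s p * (D t j p : C)^*
}.

Definition gauge (g : smooth_fun) : Prop := forall p, `|g p| = 1.

Definition gauge_act (g : smooth_fun) (D : operator) : operator :=
  fun s j p => (g p)^-1 * D (mul_fun g s) j p.

Definition gauge_class (D : operator) : set operator :=
  [set D' | exists2 g, gauge g & D' = gauge_act g D].

(* A_0 / G_U *)
Definition moduli : set (set operator) :=
  [set gauge_class D | D in hermitian_connection].

(* d + sqrt(-1) A, for a real 1-form A given by its components *)
Definition d_plus (A : 'I_(q + r) -> M -> R) : operator :=
  fun s j p => cpartial j s p + Complex 0 (A j p) * s p.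

(* The A such that D = d + sqrt(-1) A; it exists and is unique for Hermitian D
   and open B, see conn_formE and conn_form_d_plus below. *)
Definition conn_form (D : operator) : 'I_(q + r) -> M -> R :=
  xget (fun _ _ => 0) [set A | D = d_plus A].

Definition torus_act (t : dual_torus R r) (D : operator) : operator :=
  d_plus (fun j p => conn_form D j (p.1, p.2 + t)).

(* Partial connections along F_B, which is spanned by the d/dx^i. *)
Definition partial_B (D : operator) : smooth_fun -> 'I_q -> M -> C :=
  fun s i => D s (lshift r i).

Definition d_B : smooth_fun -> 'I_q -> M -> C :=
  fun s i => cpartial (lshift r i) s.

(* d + sqrt(-1) sum_a u^a dy^a *)
Definition nabla (u : B -> 'rV[R]_r) : operator :=
  d_plus (fun j p => match fintype.split j with inl _ => 0 | inr a => u p.1 0 a end).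

Definition fourier_mukai (S : set (B * torus R r)) : set operator :=
  gauge_class (nabla (lift_of (graph_map S))).

Lemma fourier_mukai_graph (u : B -> torus R r) :
  fourier_mukai (graph u) = gauge_class (nabla (lift_of u)).
Proof. by rewrite /fourier_mukai graphK. Qed.

Section Open.
Hypothesis oB : open B.

Lemma near_unroll_cst (c : R) z : B (lsubmx z) ->
  \forall w \near z, unroll (fun=> c) w = c.
Proof.
move=> Bz; have : \forall w \near z, B (lsubmx w).
  by apply: continuous_lsubmx; exact: open_nbhs_nbhs.
by apply: filterS => w Bw; rewrite /unroll insubT //=; exact: mem_set.
Qed.

Lemma msmooth_cst (c : R) : msmooth (fun=> c).
Proof.
move=> z Bz k; apply: near_eq_Ck_at (Ck_at_cst k c z).
by move: (near_unroll_cst c Bz); apply: filterS => w ->.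
Qed.

Lemma mpartial_cst j (c : R) p : mpartial j (fun=> c) p = 0.
Proof.
rewrite /mpartial /pderiv; set z := row_mx _ _.
rewrite -[RHS](derive_cst c z (delta_mx 0 j)).
by apply/near_eq_derive/near_unroll_cst; rewrite row_mxKl; exact: set_mem (valP _).
Qed.

Lemma cpartial_cst j (c : C) p : cpartial j (fun=> c) p = 0.
Proof. by rewrite /cpartial !mpartial_cst. Qed.

Definition one_fun : smooth_fun :=
  SmoothFun (conj (msmooth_cst 1) (msmooth_cst 0) : csmooth (fun=> 1)).

Lemma cpartial_one j p : cpartial j one_fun p = 0.
Proof. exact: cpartial_cst. Qed.

Lemma d_plus_inj : injective d_plus.
Proof.
move=> A A' eqA; apply/funext => j; apply/funext => p.
have := congr1 (fun D : operator => D one_fun j p) eqA.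
by rewrite /d_plus !cpartial_one !add0r !mulr1 => -[].
Qed.

Lemma hermitian_connectionE D :
  hermitian_connection D -> exists A, D = d_plus A.
Proof.
move=> hD; exists (fun j p => complex.Im (D one_fun j p)).
apply/funext => s; apply/funext => j; apply/funext => p.
have imD : D one_fun j p = Complex 0 (complex.Im (D one_fun j p)).
  have := conn_metric hD one_fun one_fun j p.
  rewrite (_ : (fun _ => _) = fun=> 1); last first.
    by apply/funext => x; rewrite /= conjC1 mulr1.
  rewrite cpartial_cst /= conjC1 mulr1 mul1r.
  case: (D one_fun j p) => a b; move/eqP; rewrite eq_complex /= => /andP[/eqP + _].
  by move/esym/eqP; rewrite -mulr2n mulrn_eq0 /= => /eqP ->.
have {1}-> : s = mul_fun s one_fun by apply: smooth_fun_eq => x; rewrite /= mulr1.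
by rewrite (conn_leibniz hD) /= mulr1 /d_plus imD [in RHS]mulrC.
Qed.

Lemma conn_form_d_plus A : conn_form (d_plus A) = A.
Proof. by apply: xget_unique => // A' /d_plus_inj. Qed.

Lemma conn_formE D : hermitian_connection D -> D = d_plus (conn_form D).
Proof. by move=> /hermitian_connectionE [A ->]; rewrite conn_form_d_plus. Qed.

Lemma torus_act_d_plus t A :
  torus_act t (d_plus A) = d_plus (fun j p => A j (p.1, p.2 + t)).
Proof. by rewrite /torus_act conn_form_d_plus. Qed.

End Open.
End Mirror.

Arguments moduli {R q} r B.
Arguments d_B {R q r B}.
Arguments fourier_mukai {R q r B} S.

(* Main.v *)
Require Import Defs.
From mathcomp Require Import all_boot all_order all_algebra.
From mathcomp Require Import generic_quotient ring_quotient.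
From mathcomp Require Import all_classical all_reals all_analysis.
From mathcomp.real_closed Require Import complex.
From mathcomp Require Import ring lra.

(** A Hermitian connection on the trivial line bundle is [d + sqrt(-1) A] for a
real 1-form [A], and a unitary gauge transformation [g] adds to [A] the real
form [g^-1 dg / sqrt(-1)] ([gauge_act_d_plus]).  Invariance under the dual
torus says that the components of [A] do not depend on [y], and the condition
on the partial connection says that its [dx^i] components vanish.  Hence the
distinguished representatives are exactly the connections [nabla f] with
[f : B -> R^r] smooth ([invariant_nabla]), and everything reduces to one
claim: [nabla f] and [nabla g] are gauge equivalent if and only if [f] and [g]
induce the same map to [T^r].

If [h] carries [nabla f] to [nabla g], then along the circle through [(x, t)]
in the direction [y^a] it satisfies [dh/dy = sqrt(-1) c h], where [c] is the
[a]-th component of [g x - f x].  So [h] is a multiple of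
[exp (sqrt(-1) c y)], and having period 1 it forces [c] to lie in [2 pi Z]
([maurer_cartan_integral], [gauge_class_nabla_inj]).  Conversely, if [f] and
[g] lift the same map, then [g - f] is continuous with values in [2 pi Z^r];
as the contraction joins every point of [B] to its centre by a path, this
difference is a constant [2 pi m] ([lift_unique]), and the character
[exp (2 pi sqrt(-1) m . y)] is a gauge transformation between the two
connections ([gauge_class_nabla]).

The claim speaks of lifts, so it must be known that a smooth [u : B -> T^r] has
a smooth one ([smooth_lift_exists]).  The contraction turns [u] into a family of
paths in [T^r] that all end at the same point.  Each path is lifted from that
end by cutting it into small steps and summing the logarithms of the steps;
the compactness of [0, 1] allows the same number of steps for all nearby
points, and the uniqueness of lifted paths makes the result independent of
that number.  The lift obtained is therefore continuous, and it is smooth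
because it differs from any local smooth lift by a locally constant vector. *)

Import numFieldNormedType.Exports.
Import Order.TTheory GRing.Theory Num.Theory.

Set Implicit Arguments.
Unset Strict Implicit.
Unset Printing Implicit Defensive.

Local Open Scope classical_set_scope.
Local Open Scope ring_scope.
Local Open Scope quotient_scope.

(** * Tori as quotients, and the logarithm near the origin *)

Section Torus.
Context {R : realType} {r : nat}.
Implicit Types (v w : 'rV[R]_r) (t : torus R r).

Lemma quotient_torus_eqP (c : R) v w :
  \pi_(quotient_torus R c r) v = \pi_(quotient_torus R c r) w <->
  exists m : 'rV[int]_r, v = w + c *: map_mx intr m.
Proof.
split.
  move/eqP; rewrite -Quotient.idealrBE => /asboolP[m vw].
  by exists m; rewrite -vw addrC subrK.
case=> m vw; apply/eqP; rewrite -Quotient.idealrBE.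
by apply/asboolP; exists m; rewrite vw addrC addKr.
Qed.

Lemma torus_pi_eqP v w : torus_pi v = torus_pi w <->
  exists m : 'rV[int]_r, v = w + (2 * pi) *: map_mx intr m.
Proof. exact: quotient_torus_eqP. Qed.

Lemma dual_torus_pi_eqP v w : dual_torus_pi v = dual_torus_pi w <->
  exists m : 'rV[int]_r, v = w + map_mx intr m.
Proof.
rewrite /dual_torus_pi quotient_torus_eqP.
by split=> -[m ->]; exists m; rewrite scale1r.
Qed.

Lemma torus_piB v w : torus_pi (v - w) = torus_pi v - torus_pi w.
Proof. exact: (raddfB (\pi_(quotient_torus R (2 * pi) r))). Qed.

Lemma torus_piD v w : torus_pi (v + w) = torus_pi v + torus_pi w.
Proof. exact: (raddfD (\pi_(quotient_torus R (2 * pi) r))). Qed.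

Lemma torus_pi0 : torus_pi 0 = 0 :> torus R r.
Proof. exact: (raddf0 (\pi_(quotient_torus R (2 * pi) r))). Qed.

Lemma dual_torus_pi0 : dual_torus_pi 0 = 0 :> dual_torus R r.
Proof. exact: (raddf0 (\pi_(quotient_torus R 1 r))). Qed.

Lemma dual_torus_reprK (t : dual_torus R r) : dual_torus_pi (repr t) = t.
Proof. exact: reprK. Qed.

Lemma torus_reprK t : torus_pi (repr t : 'rV[R]_r) = t.
Proof. exact: reprK. Qed.

(** The open ball of radius [e] at the origin for the quotient of the sup norm;
convergence in the torus is expressed through these balls. *)
Definition tsmall (e : R) t := exists2 v, `|v| < e & torus_pi v = t.

Lemma tsmallB e e' t t' : tsmall e t -> tsmall e' t' -> tsmall (e + e') (t - t').
Proof.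
move=> [v ve <-] [w we' <-]; exists (v - w); last exact: torus_piB.
by apply: le_lt_trans (ler_normB _ _) _; exact: ltrD.
Qed.

(** The local inverse of [torus_pi] on the ball of radius 1, where it is unique
by [torus_pi_inj_small]. *)
Definition tlog t : 'rV[R]_r := xget 0 [set v | `|v| < 1 /\ torus_pi v = t].

Lemma int_norm_lt1 (z : int) : `|(z%:~R : R)| < 1 -> z = 0.
Proof. by rewrite -intr_norm -[1]/(1%:~R) ltr_int; case: z => [[]|]. Qed.

Lemma mxE_norm_lt (n : nat) (v : 'rV[R]_n) e a : `|v| < e -> `|v 0 a| < e.
Proof.
move=> ve; apply: le_lt_trans ve.
rewrite /Num.Def.normr /= mx_normrE.
exact: (@le_bigmax _ _ _ _ (fun ij => `|v ij.1 ij.2|) (0, a)).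
Qed.

(** A nonzero vector of [2 pi Z^r] has sup norm at least [2 pi], and [pi >= 2].
The bound 4 leaves room for the sum of three vectors of norm 1 that occurs in
[tlog_close]. *)
Lemma lattice_lt_eq0 (m : 'rV[int]_r) :
  `|(2 * pi) *: map_mx intr m : 'rV[R]_r| < 4 -> m = 0.
Proof.
move=> m4; apply/rowP => a; rewrite mxE; apply: int_norm_lt1.
have := mxE_norm_lt a m4; rewrite !mxE normrM.
have := @pi_ge2 R; set p := pi => p2; rewrite (ger0_norm (_ : 0 <= 2 * p)); last by lra.
have := normr_ge0 ((m 0 a)%:~R : R); set x := `|_|; nra.
Qed.

Lemma torus_pi_inj_small v w : torus_pi v = torus_pi w -> `|v - w| < 4 -> v = w.
Proof.
move/torus_pi_eqP => [m ->]; rewrite addrC addKr => /lattice_lt_eq0 ->.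
by rewrite map_mx0 scaler0 addr0.
Qed.

Lemma tlogP t : tsmall 1 t -> `|tlog t| < 1 /\ torus_pi (tlog t) = t.
Proof. by move=> [v v1 vt]; apply: (@xgetPex _ 0 [set v | `|v| < 1 /\ torus_pi v = t]); exists v. Qed.

Lemma tlog0 : tlog 0 = 0.
Proof.
have /tlogP[l1 l0] : tsmall 1 (0 : torus R r) by exists 0; rewrite ?normr0 ?torus_pi0.
apply: torus_pi_inj_small; rewrite ?l0 ?torus_pi0// subr0; apply: lt_trans l1 _; lra.
Qed.

(** The two logarithms have norm less than 1, and so has the short vector [v]
that represents [t - t']; hence [tlog t - tlog t'] and [v], which agree modulo
the lattice, are at distance less than 3 and coincide. *)
Lemma tlog_close e t t' : e <= 1 -> tsmall 1 t -> tsmall 1 t' -> tsmall e (t - t') ->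
  `|tlog t - tlog t'| < e.
Proof.
move=> e1 /tlogP[lt tt] /tlogP[lt' tt'] [v ve vt].
suff -> : tlog t - tlog t' = v by [].
apply: torus_pi_inj_small; first by rewrite torus_piB tt tt' vt.
apply: le_lt_trans (ler_normB _ _) _.
have := ler_normB (tlog t) (tlog t'); lra.
Qed.

End Torus.

Section TorusCvg.
Context {R : realType} {r : nat} {X : Type} {F : set_system X} {FF : Filter F}.
Implicit Types (g h : X -> torus R r).

Definition tcvg g (t : torus R r) :=
  forall e : R, 0 < e -> \forall x \near F, tsmall e (g x - t).

Lemma tcvgB g h a b : tcvg g a -> tcvg h b -> tcvg (fun x => g x - h x) (a - b).
Proof.
move=> ga hb e e0; have e20 : 0 < e / 2 by lra.
move: (ga _ e20) (hb _ e20); apply: filterS2 => x gx hx.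
rewrite (_ : _ - _ = (g x - a) - (h x - b)); last first.
  by rewrite !opprB addrACA [RHS]addrACA [- h x + _]addrC.
by rewrite [e]splitr; exact: tsmallB.
Qed.

Lemma tlog_cvg g a : tsmall 1 a -> (\forall x \near F, tsmall 1 (g x)) ->
  tcvg g a -> tlog (g x) @[x --> F] --> tlog a.
Proof.
move=> a1 g1 ga; apply/cvgrPdistC_lt => e e0.
have m0 : 0 < Num.min e 1 by rewrite lt_min e0 ltr01.
move: g1 (ga _ m0); apply: filterS2 => x gx1 gxa.
have m1 : Num.min e 1 <= 1 by rewrite ge_min lexx orbT.
have := tlog_close m1 gx1 a1 gxa.
by rewrite lt_min => /andP[].
Qed.

Lemma tcvg_pi (f : X -> 'rV[R]_r) v : f x @[x --> F] --> v ->
  tcvg (fun x => torus_pi (f x)) (torus_pi v).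
Proof.
move=> /cvgrPdistC_lt fv e e0; move: (fv _ e0); apply: filterS => x fx.
by exists (f x - v); rewrite ?torus_piB.
Qed.

End TorusCvg.
Arguments tcvg {R r X} F g t.

Lemma within_cvgP (X Y : topologicalType) (A : set X) (f : X -> Y) :
  {within A, continuous f} <->
  (forall x, A x -> f y @[y --> within A (nbhs x)] --> f x).
Proof. exact: subspace_continuousP. Qed.

Section CvgCoord.
Context {R : realType} {r : nat} {X : Type} {F : set_system X} {FF : Filter F}.
Implicit Types (f : X -> 'rV[R]_r) (v : 'rV[R]_r).

Lemma cvg_coord f v a : f x @[x --> F] --> v -> f x 0 a @[x --> F] --> v 0 a.
Proof.
move=> fv; apply: (cvg_comp (fun x => f x) (fun M : 'rV[R]_r => M 0 a) fv).
exact: (@coord_continuous R 1 r 0 a v).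
Qed.

Lemma cvg_rowP f v : (forall a, f x 0 a @[x --> F] --> v 0 a) ->
  f x @[x --> F] --> v.
Proof.
move=> fv; apply/cvgrPdist_lt => e e0.
have : \forall x \near F, forall a, `|v 0 a - f x 0 a| < e.
  by apply: filter_forall => a; move/cvgrPdist_lt: (fv a); exact.
apply: filterS => x vx; rewrite /Num.Def.normr /= mx_normrE.
apply: Order.POrderTheory.bigmax_lt => // -[i a] _ /=.
by rewrite (ord1 i) !mxE.
Qed.

End CvgCoord.

(** * Lifting paths to the universal cover of the torus *)

Section PathUnique.
Context {R : realType} {r : nat}.

(** A path in the discrete set [2 pi Z] is constant: if its end values differed,
the intermediate value theorem would give it a value [pi] above the smaller of
them, which is halfway between two consecutive points of [2 pi Z]. *)
Lemma lattice_path_cst (h : R -> R) : {within `[0, 1], continuous h} ->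
  (forall s, 0 <= s <= 1 -> exists m : int, h s = (2 * pi) * m%:~R) -> h 0 = h 1.
Proof.
move=> hc hZ; have p0 := @pi_gt0 R.
have [m h0] : exists m : int, h 0 = (2 * pi) * m%:~R by apply: hZ; rewrite lexx ler01.
have [n h1] : exists m : int, h 1 = (2 * pi) * m%:~R by apply: hZ; rewrite lexx ler01.
have [->|mn] := eqVneq (h 0) (h 1); first by [].
have nm : m != n by apply: contra mn => /eqP mn; rewrite h0 h1 mn.
have [c /[!in_itv]/= c01 hc'] : exists2 c, c \in `[0, 1] & h c = Num.min (h 0) (h 1) + pi.
  apply: IVT => //; rewrite lerDl pi_ge0/= -lerBrDl.
  rewrite h0 h1; set p := pi in p0 *.
  have [lmn|lnm|/eqP] := ltgtP m n; last by rewrite (negPf nm).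
    have : (m + 1)%:~R <= n%:~R :> R by rewrite ler_int; rewrite lezD1.
    rewrite intrD => H; rewrite min_l ?max_r; nra.
  have : (n + 1)%:~R <= m%:~R :> R by rewrite ler_int; rewrite lezD1.
  rewrite intrD => H; rewrite min_r ?max_l; nra.
have [k hk] := hZ _ c01.
have [l hl] : exists l : int, Num.min (h 0) (h 1) = (2 * pi) * l%:~R.
  by rewrite minEle; case: ifP => _; [exists m|exists n].
have : (2 * (k - l))%:~R = 1%:~R :> R.
  rewrite intrM intrB; apply: (mulfI (lt0r_neq0 p0)).
  move: hc'; rewrite hk hl; set p := pi => ?; lra.
move/eqP; rewrite eqr_int => /eqP /(congr1 (fun z : int => odd `|z|%N)).
by rewrite abszM oddM.
Qed.

(** Two lifts of a path differ by a constant.  The difference of the end values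
is kept general because lifts of a map on [B] are compared by it as well, where
neither end value is prescribed. *)
Lemma path_lift_unique (phi psi : R -> 'rV[R]_r) :
  {within `[0, 1], continuous phi} -> {within `[0, 1], continuous psi} ->
  (forall s, 0 <= s <= 1 -> torus_pi (phi s) = torus_pi (psi s)) ->
  phi 0 - psi 0 = phi 1 - psi 1.
Proof.
move=> /within_cvgP cphi /within_cvgP cpsi eqpi.
apply/rowP => a.
apply: (@lattice_path_cst (fun s => (phi s - psi s) 0 a)).
  apply/within_cvgP => s s01.
  by apply: cvg_coord; apply: cvgB; [exact: cphi|exact: cpsi].
move=> s /eqpi/torus_pi_eqP[m ->]; exists (m 0 a).
by rewrite addrC addKr !mxE.
Qed.

End PathUnique.

Section PathLift.
Context {R : realType} {q r : nat} {B : set 'rV[R]_q}.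
(* [W] is a homotopy on [0, 1] x B, continuous there. *)
Context (W : R -> 'rV[R]_q -> torus R r).
Context (cW : forall (s : R) y, 0 <= s <= 1 -> B y -> forall e : R, 0 < e ->
  \forall p \near (s, y), 0 <= p.1 <= 1 -> B p.2 ->
    tsmall e (W p.1 p.2 - W s y)).

Definition fine_mesh (N : nat) (y : 'rV[R]_q) := forall s s' : R,
  0 <= s <= 1 -> 0 <= s' <= 1 -> `|s - s'| <= N.+1%:R^-1 ->
  tsmall 1 (W s y - W s' y).

(** Uniform continuity on the compact segment, locally uniformly in the
parameter: this is what lets one subdivision serve for a whole neighbourhood. *)
Lemma near_fine_mesh y0 : B y0 ->
  exists N, \forall y \near y0, B y -> fine_mesh N y.
Proof.
move=> By0.
(* The step size and the parameter vary together in the covering argument. *)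
pose P (i : R * 'rV[R]_q) (s : R) := B i.2 -> 0 <= s <= 1 -> forall s' : R, 0 <= s' <= 1 ->
  `|s - s'| <= `|i.1| -> tsmall 1 (W s i.2 - W s' i.2).
have : \forall i \near (0 : R, y0), `[0, 1] `<=` P i.
  have /compact_near_coveringP cov := @segment_compact R 0 1.
  apply: (cov _ (nbhs (0 : R, y0)) P _) => s0.
  rewrite /= in_itv/= => s01.
  have h0 : 0 < 1 / 2 :> R by lra.
  have /nbhs_ballP[d /= d0 dP] := cW s01 By0 h0.
  have d20 : 0 < d / 2 by lra.
  exists (ball s0 (d / 2), ball (0, y0) (d / 2)) => /=.
    by split; exact: nbhsx_ballx.
  move=> [s [e y]] /=; rewrite /ball/= => -[+ [+ yb]] By s1 s' s'1 ss'.
  rewrite -!(ball_normE) /= sub0r normrN => sb eb.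
  rewrite [1]splitr (_ : W s y - W s' y = (W s y - W s0 y0) - (W s' y - W s0 y0)); last first.
    by rewrite opprB addrA subrK.
  have yb' : ball y0 d y by apply: le_ball yb; lra.
  apply: tsmallB; [apply: (dP (s, y))|apply: (dP (s', y))] => //=;
    split=> //=; rewrite -ball_normE /=.
    by apply: lt_trans sb _; lra.
  have := ler_normD (s0 - s) (s - s'); rewrite addrA subrK; lra.
move=> /nbhs_ballP[e /= e0 eP].
have [N _ /(_ N (leqnn N)) /= Ne] := near_infty_natSinv_lt (PosNum e0).
have N0 : 0 <= N.+1%:R^-1 :> R by rewrite invr_ge0 ler0n.
exists N; have := nbhsx_ballx y0 e e0; apply: filterS => y yb By s s' s1 s'1 ss'.
apply: (eP (N.+1%:R^-1, y)) => //=; last by rewrite (ger0_norm N0).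
by split => //=; rewrite -ball_normE /= sub0r normrN (ger0_norm N0).
Qed.

(* All paths end at the same point of the torus, and are lifted from there. *)
Context (f0 : 'rV[R]_r) (W1 : forall y, B y -> W 1 y = torus_pi f0).

Definition node (N k : nat) : R := k%:R / N.+1%:R.

(** The increments telescope to [W s y - W 1 y].  Replacing [s] and the nodes by
their maxima makes the steps before time [s] trivial, so that one finite sum
depends continuously on [s] across the nodes. *)
Definition path_lift (N : nat) (y : 'rV[R]_q) (s : R) : 'rV[R]_r :=
  f0 + \sum_(k < N.+1)
    tlog (W (Num.max s (node N k)) y - W (Num.max s (node N k.+1)) y).

Lemma node01 N k : (k <= N.+1)%N -> 0 <= node N k <= 1.
Proof.
move=> kN; rewrite /node divr_ge0 ?ler0n//= ler_pdivrMr ?ltr0n// mul1r.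
by rewrite ler_nat.
Qed.

Lemma max_node01 N k s : (k <= N.+1)%N -> 0 <= s <= 1 ->
  0 <= Num.max s (node N k) <= 1.
Proof.
by move=> /node01/andP[k0 k1] /andP[s0 s1]; rewrite le_max s0/= ge_max s1.
Qed.

Lemma max_dist (a b c : R) : `|Num.max a c - Num.max b c| <= `|a - b|.
Proof.
have [ab|ab] := leP a b; rewrite ler_norml; have := normr_ge0 (a - b).
  rewrite ler0_norm ?subr_le0// => _.
  by case: (leP a c); case: (leP b c); lra.
rewrite gtr0_norm ?subr_gt0// => _.
by case: (leP a c); case: (leP b c); lra.
Qed.

Lemma fine_mesh_node N y s (k : 'I_N.+1) : fine_mesh N y -> 0 <= s <= 1 ->
  tsmall 1 (W (Num.max s (node N k)) y - W (Num.max s (node N k.+1)) y).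
Proof.
move=> fN s01; apply: fN; rewrite ?max_node01//; first exact: ltnW.
rewrite ![Num.max s _]maxC; apply: le_trans (max_dist _ _ _) _.
rewrite distrC /node -mulrBl -natrB// subSnn mul1r ger0_norm//.
Qed.

Lemma path_lift_pi N y s : B y -> fine_mesh N y -> 0 <= s <= 1 ->
  torus_pi (path_lift N y s) = W s y.
Proof.
move=> By fN s01; rewrite /path_lift torus_piD.
rewrite (big_morph _ torus_piD torus_pi0).
under eq_bigr => k _.
  have [_ ->] := tlogP (fine_mesh_node k fN s01).
  rewrite -opprB; over.
rewrite sumrN -(big_mkord xpredT (fun k => W (Num.max s (node N k.+1)) y -
  W (Num.max s (node N k)) y)) telescope_sumr//.
rewrite /node mul0r divff ?pnatr_eq0//.
by case/andP: s01 => s0 s1; rewrite (max_l s0) (max_r s1) W1// opprB addrC subrK.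
Qed.

Lemma path_lift1 N y : path_lift N y 1 = f0.
Proof.
rewrite /path_lift big1 ?addr0// => k _.
have /node01/andP[_ k1] : (k.+1 <= N.+1)%N by [].
have /node01/andP[_ k2] : (k <= N.+1)%N by rewrite ltnW.
by rewrite (max_l k1) (max_l k2) subrr tlog0.
Qed.

Lemma path_lift_cvg (X : Type) (F : set_system X) {FF : Filter F}
    (s : X -> R) (y : X -> 'rV[R]_q) N (s1 : R) (y0 : 'rV[R]_q) :
  0 <= s1 <= 1 -> B y0 -> fine_mesh N y0 ->
  s x @[x --> F] --> s1 -> y x @[x --> F] --> y0 ->
  (\forall x \near F, [/\ 0 <= s x <= 1, B (y x) & fine_mesh N (y x)]) ->
  path_lift N (y x) (s x) @[x --> F] --> path_lift N y0 s1.
Proof.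
move=> s101 By0 fN0 ss yy H; apply: cvgD; first exact: cvg_cst.
apply: cvg_big => [|k _]; first exact: add_continuous.
apply: tlog_cvg; first exact: fine_mesh_node.
  by move: H; apply: filterS => x [] *; exact: fine_mesh_node.
have WW (l : nat) : (l <= N.+1)%N -> tcvg F
    (fun x => W (Num.max (s x) (node N l)) (y x)) (W (Num.max s1 (node N l)) y0).
  move=> lN e e0.
  have := cW (max_node01 lN s101) By0 e0.
  have mm : Num.max (s x) (node N l) @[x --> F] --> Num.max s1 (node N l).
    apply/cvgrPdist_lt => d d0; move/cvgrPdist_lt: ss => /(_ d d0).
    by apply: filterS => x; apply: le_lt_trans (max_dist _ _ _).
  move/(cvg_pair mm yy) => /=; move: H; apply: filterS2 => x [sx Bx _].
  by apply => //; exact: max_node01.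
by apply: tcvgB; apply: WW => //; exact: ltnW.
Qed.

Definition is_path_lift (y : 'rV[R]_q) (phi : R -> 'rV[R]_r) :=
  [/\ {within `[0, 1], continuous phi},
      (forall s, 0 <= s <= 1 -> torus_pi (phi s) = W s y) & phi 1 = f0].

Lemma path_liftP N y : B y -> fine_mesh N y -> is_path_lift y (path_lift N y).
Proof.
move=> By fN; split; last exact: path_lift1; last by move=> *; exact: path_lift_pi.
apply/within_cvgP => s /=; rewrite in_itv/= => s01.
apply: path_lift_cvg => //; [exact: cvg_within|exact: cvg_cst|].
by have := near_withinT `[0, 1]%classic (nbhs_filter s); apply: filterS.
Qed.

(** By the uniqueness of path lifts this does not depend on the subdivision,
which [path_lift N y 0] does not make visible. *)
Definition end_lift (y : 'rV[R]_q) : 'rV[R]_r :=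
  xget 0 [set v | exists2 phi, is_path_lift y phi & phi 0 = v].

Lemma end_liftE y phi : is_path_lift y phi -> end_lift y = phi 0.
Proof.
move=> yphi; apply: xget_unique; first by exists phi.
move=> v [psi ypsi <-]; case: yphi ypsi => [c p e] [c' p' e'].
apply/esym/eqP; rewrite -subr_eq0 (path_lift_unique c c') ?e ?e' ?subrr//.
by move=> s s01; rewrite p ?p'.
Qed.

Lemma end_lift_pi y : B y -> torus_pi (end_lift y) = W 0 y.
Proof.
move=> By; have [N /nbhs_singleton /(_ By) fN] := near_fine_mesh By.
by rewrite (end_liftE (path_liftP By fN)) path_lift_pi// lexx ler01.
Qed.

(** Near [y] the same [N] may be used for all points, and then [end_lift] is a
finite sum of continuous functions. *)
Lemma end_lift_continuous y : open B -> B y -> {for y, continuous end_lift}.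
Proof.
move=> oB By; have [N nfN] := near_fine_mesh By.
have nB : \forall z \near y, B z by exact: open_nbhs_nbhs.
have nf : \forall z \near y, B z /\ fine_mesh N z.
  by move: nB nfN; apply: filterS2 => z Bz /(_ Bz).
have [_ fN] := nbhs_singleton nf.
rewrite /prop_for /continuous_at (end_liftE (path_liftP By fN)).
have : path_lift N z 0 @[z --> y] --> path_lift N y 0.
  apply: (@path_lift_cvg _ (nbhs y) _ (fun=> 0) id) => //.
  - by rewrite lexx ler01.
  - exact: cvg_cst.
  - by move: nf; apply: filterS => z [? ?]; split=> //; rewrite lexx ler01.
have eqn : \forall z \near y, path_lift N z 0 = end_lift z.
  by move: nf; apply: filterS => z [Bz fz]; rewrite (end_liftE (path_liftP Bz fz)).
apply: cvg_trans; exact: (@near_eq_cvg _ _ (nbhs y)).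
Qed.

End PathLift.

(** * Smooth functions and coordinate maps *)

Section SmoothBasics.
Context {R : realType} {n : nat}.
Implicit Types (f g : 'rV[R]_n -> R) (x : 'rV[R]_n).

Lemma Ck_at_continuous k f x : Ck_at k f x -> {for x, continuous f}.
Proof. by case: k => [|k] [/nbhs_singleton]. Qed.

Lemma smooth_at_continuous f x : smooth_at f x -> {for x, continuous f}.
Proof. by move=> /(_ 0%N)/Ck_at_continuous. Qed.

Lemma smooth_at_derivable f x j : smooth_at f x -> derivable f x (delta_mx 0 j).
Proof. by move=> /(_ 1%N) [_ [/(_ j)/nbhs_singleton]]. Qed.

Lemma smooth_at_pderiv f x j : smooth_at f x -> smooth_at (pderiv j f) x.
Proof. by move=> sf k; have [_ [_ /(_ j)]] := sf k.+1. Qed.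

Lemma near_eq_smooth_at f g x : (\forall y \near x, f y = g y) ->
  smooth_at f x -> smooth_at g x.
Proof. by move=> fg sf k; exact: near_eq_Ck_at fg (sf k). Qed.

Lemma smooth_at_cst (c : R) x : smooth_at (cst c) x.
Proof. by move=> k; exact: Ck_at_cst. Qed.

Lemma smooth_atD f g x : smooth_at f x -> smooth_at g x -> smooth_at (f \+ g) x.
Proof. by move=> sf sg k; exact: Ck_atD. Qed.

End SmoothBasics.

Section CoordinateMaps.
Context {R : realType} {n m : nat}.

(** [L] sends the [j]-th coordinate line through any point to the [s j]-th one,
or to a single point when [s j] is [None].  This covers the projection of
[R^q x R^r] to [R^q] and its affine sections, and for such maps the chain rule
is an identity between the difference quotients themselves. *)
Definition coordinate_map (L : 'rV[R]_n -> 'rV[R]_m) (s : 'I_n -> option 'I_m) :=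
  forall j z (h : R), L (h *: delta_mx 0 j + z) =
    h *: oapp (fun k => delta_mx 0 k) 0 (s j) + L z.

Let quotient_coordinate_map L s (f : _ -> R) z j : coordinate_map L s ->
  (fun h : R => h^-1 *: ((f \o L \o shift z) (h *: delta_mx 0 j) - (f \o L) z)) =
  (fun h : R => h^-1 *: ((f \o shift (L z))
    (h *: oapp (fun k => delta_mx 0 k) 0 (s j)) - f (L z))).
Proof. by move=> Ls; apply/funext => h /=; rewrite Ls. Qed.

Lemma derive_coordinate_map L s f z j : coordinate_map L s ->
  'D_(delta_mx 0 j) (f \o L) z =
  'D_(oapp (fun k => delta_mx 0 k) 0 (s j)) f (L z) :> R.
Proof.
by move=> Ls; rewrite /derive (quotient_coordinate_map _ _ _ Ls).
Qed.

Lemma derivable_coordinate_map L s f z j : coordinate_map L s ->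
  derivable (f : _ -> R) (L z) (oapp (fun k => delta_mx 0 k) 0 (s j)) ->
  derivable (f \o L) z (delta_mx 0 j).
Proof.
by move=> Ls; rewrite /derivable (quotient_coordinate_map _ _ _ Ls).
Qed.

Lemma pderiv_coordinate_map L s f j : coordinate_map L s ->
  pderiv j (f \o L) = (oapp (fun k => pderiv k f) (cst 0) (s j)) \o L.
Proof.
move=> Ls; apply/funext => z; rewrite /pderiv (derive_coordinate_map _ _ _ Ls).
by case: (s j) => //=; rewrite derive0.
Qed.

Lemma Ck_at_coordinate_map L s k f z : continuous L -> coordinate_map L s ->
  Ck_at k f (L z) -> Ck_at k (f \o L) z.
Proof.
move=> cL Ls.
have nL (P : 'rV[R]_m -> Prop) : (\forall w \near L z, P w) -> \forall y \near z, P (L y).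
  by move=> H; exact: cL.
elim: k f => [|k IH] f /= [cf df]; split=> //;
  try by move/nL: cf; apply: filterS => y cf; exact: continuous_comp (cL y) cf.
have [df1 pf] := df; split=> j.
  case sj : (s j) => [i|].
    move/nL: (df1 i); apply: filterS => y dy; apply: derivable_coordinate_map Ls _.
    by rewrite sj.
  apply: (@nearW _ (nbhs z)) => y; apply: derivable_coordinate_map Ls _.
  by rewrite sj; exact: derivable0.
rewrite (pderiv_coordinate_map _ _ Ls).
by case: (s j) => [i|]; apply: IH => //=; exact: Ck_at_cst.
Qed.

End CoordinateMaps.

(** * Smooth lifts of maps from a contractible set to the torus *)

Section Lift.
Context {R : realType} {q r : nat} {B : set 'rV[R]_q}.

Definition extend0 {V : nmodType} (u : B -> V) (y : 'rV[R]_q) : V :=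
  oapp u 0 (insub y).

Lemma extend0E {V : nmodType} (u : B -> V) (b : B) : extend0 u (val b) = u b.
Proof. by rewrite /extend0 valK. Qed.

Lemma extend0_in {V : nmodType} (u : B -> V) y (By : B y) :
  extend0 u y = u (SigSub (mem_set By)).
Proof. by rewrite -[RHS]extend0E. Qed.

Lemma setval (b : B) : B (val b).
Proof. exact: set_mem (valP b). Qed.

Context (open_B : open B).

Lemma near_open x : B x -> \forall y \near x, B y.
Proof. by move=> Bx; exact: open_nbhs_nbhs. Qed.

Lemma torus_smooth_tcvg (u : B -> torus R r) x : torus_smooth u -> B x ->
  tcvg (nbhs x) (extend0 u) (extend0 u x).
Proof.
move=> su Bx; have [f /= fu] := su (SigSub (mem_set Bx)).
have fE : \forall y \near x, torus_pi (f y) = extend0 u y.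
  move: fu (near_open Bx); apply: filterS2 => y [_ fu] By.
  by rewrite extend0_in fu.
rewrite -(nbhs_singleton fE) => e e0.
have cf : f y @[y --> x] --> f x.
  apply: (@cvg_rowP _ _ _ (nbhs x) _ f) => a.
  by have [/(_ a)/smooth_at_continuous] := nbhs_singleton fu.
have /(_ _ e e0) := @tcvg_pi _ _ _ (nbhs x) _ f _ cf.
by move: fE; apply: filterS2 => y <-.
Qed.

(** The lift of [u x] is obtained by lifting the image under [u] of the path
that contracts [x] to the centre. *)
Lemma smooth_lift_exists (u : B -> torus R r) : contractible_set B ->
  torus_smooth u -> exists f, is_lift u f.
Proof.
move=> [x0 [H [Bx0 cH BH H0 H1]]] su.
pose W s y := extend0 u (H (s, y)).
have cW (s : R) y : 0 <= s <= 1 -> B y -> forall e : R, 0 < e ->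
    \forall p \near (s, y), 0 <= p.1 <= 1 -> B p.2 -> tsmall e (W p.1 p.2 - W s y).
  move=> s01 By e e0.
  have /within_cvgP cHp := cH.
  have sy : (`[0, 1] `*` B) (s, y) by split => //=; rewrite in_itv.
  have := cHp _ sy _ (torus_smooth_tcvg su (BH s y s01 By) e0).
  rewrite /within /nbhs /=; apply: filterS => -[s' y'] /= K s'01 By'.
  by apply: K; split=> //=; rewrite in_itv.
pose f0 := repr (u (SigSub (mem_set Bx0))) : 'rV[R]_r.
have W1 y : B y -> W 1 y = torus_pi f0.
  by move=> By; rewrite /W H1// torus_reprK extend0_in.
pose F := end_lift W f0.
have Fpi y : B y -> torus_pi (F y) = extend0 u y.
  by move=> By; rewrite (end_lift_pi cW W1 By) /W H0.
have cF y : B y -> {for y, continuous F} := end_lift_continuous cW W1 open_B.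
have sF y a : B y -> smooth_at (fun z => F z 0 a) y.
  move=> By; have [f /= fu] := su (SigSub (mem_set By)).
  have cf : f z @[z --> y] --> f y.
    apply: (@cvg_rowP _ _ _ (nbhs y) _ f) => b.
    by have [/(_ b)/smooth_at_continuous] := nbhs_singleton fu.
  have [fs _] := nbhs_singleton fu.
  have e1 : 0 < 1 :> R by [].
  (* Both sides lift [u], agree at [y] and are continuous there. *)
  have eqF : \forall z \near y, f z + (F y - f y) = F z.
    move/cvgrPdist_lt: cf => /(_ 1 e1) cf.
    move/cvgrPdist_lt: (cF y By) => /(_ 1 e1).
    have fE : \forall z \near y, torus_pi (f z) = extend0 u z.
      move: fu (near_open By); apply: filterS2 => z [_ fu'] Bz.
      by rewrite extend0_in fu'.
    move=> cF'; near=> z.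
    have Bz : B z by near: z; exact: near_open.
    have fz : torus_pi (f z) = extend0 u z by near: z.
    have fyz : `|f y - f z| < 1 by near: z.
    have Fyz : `|F y - F z| < 1 by near: z.
    apply: torus_pi_inj_small.
      by rewrite torus_piD torus_piB fz !Fpi// (nbhs_singleton fE) subrr addr0.
    rewrite (_ : _ - _ = (F y - F z) - (f y - f z)); last first.
      by apply/rowP => b; rewrite !mxE; lra.
    by apply: le_lt_trans (ler_normB _ _) _; lra.
  apply: near_eq_smooth_at (smooth_atD (fs a) (smooth_at_cst ((F y - f y) 0 a) y)).
  by move: eqF; apply: filterS => z <-; rewrite /= [RHS]mxE.
exists (fun b => F (val b)); split => [a x|x]; last by rewrite Fpi ?extend0E//; exact: setval.
apply: near_eq_smooth_at (sF (val x) a (setval x)).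
by move: (near_open (setval x)); apply: filterS => y By; rewrite /= insubT ?inE.
Unshelve. all: by end_near. Qed.

End Lift.

Section LiftUnique.
Context {R : realType} {q r : nat} {B : set 'rV[R]_q}.

Lemma extend0_cvg (f : B -> 'rV[R]_r) x : (forall a, base_smooth (fun x => f x 0 a)) ->
  B x -> extend0 f y @[y --> x] --> extend0 f x.
Proof.
move=> sf Bx; apply: (@cvg_rowP _ _ _ (nbhs x) _ (extend0 f)) => a.
have E : (fun y => oapp (fun x : B => f x 0 a) 0 (insub y)) = (fun y => extend0 f y 0 a).
  by apply/funext => y; rewrite /extend0; case: insub => //=; rewrite mxE.
by have := smooth_at_continuous (sf a (SigSub (mem_set Bx))); rewrite E.
Qed.

(** The paths of the contraction make [B] connected, which is all that is needed
to propagate the value of [f - g] at the centre. *)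
Lemma lift_unique (u : B -> torus R r) f g : contractible_set B ->
  is_lift u f -> is_lift u g ->
  exists m : 'rV[int]_r, forall x, f x = g x + (2 * pi) *: map_mx intr m.
Proof.
move=> [x0 [H [Bx0 cH BH H0 H1]]] [sf fu] [sg gu].
pose b0 : B := SigSub (mem_set Bx0).
have /torus_pi_eqP[m fg0] : torus_pi (f b0) = torus_pi (g b0) by rewrite fu gu.
exists m => x; have Bx := setval x.
have cHx (h : B -> 'rV[R]_r) : (forall a, base_smooth (fun x => h x 0 a)) ->
    {within `[0, 1], continuous (fun s : R => extend0 h (H (s, val x)))}.
  move=> sh; apply/within_cvgP => s; rewrite /= in_itv/= => s01.
  have : H (s', val x) @[s' --> within `[0, 1] (nbhs s)] --> H (s, val x).
    move/within_cvgP: cH => /(_ (s, val x)) /=.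
    have A : (`[0, 1] `*` B) (s, val x) by split; rewrite //= in_itv.
    move/(_ A) => cHp P /cHp.
    have : (s', val x) @[s' --> s] --> (s, val x).
      apply: (@cvg_pair _ _ _ (nbhs s) (nbhs s) (nbhs (val x)) _ _ _ id (fun=> val x)) => //.
      exact: cvg_cst.
    move=> c /c K.
    suff : \forall s' \near s, `[0, 1]%classic s' -> P (H (s', val x)) by [].
    by move: K; apply: (@filterS _ (nbhs s)) => s' /= HH s'01; apply: HH; split.
  by move=> c; apply: (cvg_comp _ _ c); exact: extend0_cvg (BH _ _ s01 Bx).
have eqpi (s : R) : 0 <= s <= 1 -> torus_pi (extend0 f (H (s, val x))) =
    torus_pi (extend0 g (H (s, val x))).
  by move=> s01; rewrite !(extend0_in _ (BH _ _ s01 Bx)) fu gu.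
have := path_lift_unique (cHx f sf) (cHx g sg) eqpi.
rewrite !H0// !H1// !extend0E !(extend0_in _ Bx0) -/b0 fg0 [g b0 + _]addrC addrK => <-.
by rewrite [RHS]addrC subrK.
Qed.

End LiftUnique.

(** * Partial derivatives of functions on the mirror *)

Section MirrorCalculus.
Context {R : realType} {q r : nat} {B : set 'rV[R]_q}.
Local Notation M := (mirror r B).
Implicit Types (f g : M -> R) (b : B) (v : 'rV[R]_r) (z : 'rV[R]_(q + r)).

Lemma unrollE f b v : unroll f (row_mx (val b) v) = f (b, dual_torus_pi v).
Proof. by rewrite /unroll row_mxKl row_mxKr valK. Qed.

Lemma unroll_in f z (Bz : B (lsubmx z)) :
  unroll f z = f (SigSub (mem_set Bz), dual_torus_pi (rsubmx z)).
Proof. by rewrite -unrollE /= hsubmxK. Qed.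

Lemma unroll_periodic f z (m : 'rV[int]_r) :
  unroll f (z + row_mx 0 (map_mx intr m)) = unroll f z.
Proof.
rewrite -{1}[z]hsubmxK add_row_mx addr0 /unroll row_mxKl row_mxKr.
case: insub => //= b; congr (f (_, _)).
by apply/dual_torus_pi_eqP; exists m.
Qed.

(** The representative chosen in the definition of [mpartial] is immaterial,
since [unroll f] is periodic. *)
Lemma mpartialE j f b v :
  mpartial j f (b, dual_torus_pi v) = pderiv j (unroll f) (row_mx (val b) v).
Proof.
rewrite /mpartial /=.
have /dual_torus_pi_eqP[m ->] := dual_torus_reprK (dual_torus_pi v).
have -> : row_mx (val b) (v + map_mx intr m) =
    row_mx (val b) v + row_mx 0 (map_mx intr m).
  by rewrite add_row_mx addr0.
rewrite /pderiv /derive unroll_periodic.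
have -> // : unroll f \o shift (row_mx (val b) v + row_mx 0 (map_mx intr m)) =
    unroll f \o shift (row_mx (val b) v).
by apply/funext => w /=; rewrite addrA unroll_periodic.
Qed.

Lemma unroll_mpartial j f z : B (lsubmx z) ->
  unroll (mpartial j f) z = pderiv j (unroll f) z.
Proof. by move=> Bz; rewrite unroll_in mpartialE /= hsubmxK. Qed.

Context (open_B : open B).

Lemma near_lsubmx z : B (lsubmx z) -> \forall w \near z, B (lsubmx w).
Proof.
by move=> Bz; apply: continuous_lsubmx; exact: open_nbhs_nbhs.
Qed.

(** [unroll f] is extended by 0, so a formula [F] for it holds only over [B];
as [B] is open, that is enough to decide smoothness. *)
Lemma near_eq_msmooth f (F : 'rV[R]_(q + r) -> R) :
  (forall z, B (lsubmx z) -> unroll f z = F z) ->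
  (forall z, B (lsubmx z) -> smooth_at F z) -> msmooth f.
Proof.
move=> fF sF z Bz; apply: near_eq_smooth_at (sF z Bz).
by move: (near_lsubmx Bz); apply: filterS => w Bw; rewrite fF.
Qed.

Lemma msmooth_mpartial j f : msmooth f -> msmooth (mpartial j f).
Proof.
move=> sf; apply: (near_eq_msmooth (F := pderiv j (unroll f))).
  by move=> z; exact: unroll_mpartial.
by move=> z Bz; apply/smooth_at_pderiv/sf.
Qed.

Lemma msmooth_derivable j f (p : M) : msmooth f ->
  derivable (unroll f) (row_mx (val p.1) (repr p.2)) (delta_mx 0 j).
Proof.
move=> sf; apply/smooth_at_derivable/sf; rewrite row_mxKl; exact: setval.
Qed.

Lemma unrollD f g : unroll (fun p => f p + g p) = unroll f + unroll g.
Proof.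
apply/funext => z; transitivity (unroll f z + unroll g z) => //.
by rewrite /unroll; case: insub => //=; rewrite addr0.
Qed.

Lemma unrollN f : unroll (fun p => - f p) = - unroll f.
Proof.
apply/funext => z; transitivity (- unroll f z) => //.
by rewrite /unroll; case: insub => //=; rewrite oppr0.
Qed.

Lemma unrollM f g : unroll (fun p => f p * g p) = unroll f \* unroll g.
Proof.
apply/funext => z; transitivity (unroll f z * unroll g z) => //.
by rewrite /unroll; case: insub => //=; rewrite mulr0.
Qed.

Lemma mpartialD j f g p : msmooth f -> msmooth g ->
  mpartial j (fun p => f p + g p) p = mpartial j f p + mpartial j g p.
Proof.
by move=> sf sg; rewrite /mpartial /pderiv unrollD deriveD//;
  exact: msmooth_derivable.
Qed.

Lemma mpartialN j f p : msmooth f ->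
  mpartial j (fun p => - f p) p = - mpartial j f p.
Proof.
by move=> sf; rewrite /mpartial /pderiv unrollN deriveN//;
  exact: msmooth_derivable.
Qed.

Lemma mpartialM j f g p : msmooth f -> msmooth g ->
  mpartial j (fun p => f p * g p) p = f p * mpartial j g p + g p * mpartial j f p.
Proof.
move=> sf sg; case: p => b t.
have fE h : h (b, t) = unroll h (row_mx (val b) (repr t)).
  by rewrite unrollE dual_torus_reprK.
rewrite (fE f) (fE g) /mpartial /pderiv unrollM.
exact: (deriveM (@msmooth_derivable j f (b, t) sf)
                (@msmooth_derivable j g (b, t) sg)).
Qed.

Definition base_index (j : 'I_(q + r)) : option 'I_q :=
  match fintype.split j with inl i => Some i | inr _ => None end.

Lemma lsubmx_coordinate_map :
  coordinate_map (fun z : 'rV[R]_(q + r) => lsubmx z) base_index.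
Proof.
move=> j z h; apply/rowP => k; rewrite !mxE /base_index eqxx /=; congr (_ * _ + _).
case: split_ordP => i ->; rewrite /= ?mxE ?eqxx /=.
  by rewrite (inj_eq (@lshift_inj _ _)).
by rewrite eq_lrshift.
Qed.

Lemma row_mx_coordinate_map v :
  coordinate_map (fun x : 'rV[R]_q => row_mx x v) (fun i => Some (lshift r i)).
Proof.
move=> j z h; apply/rowP => k; rewrite !mxE /=.
case: split_ordP => i -> /=.
  by rewrite !mxE /= (inj_eq (@lshift_inj _ _)).
by rewrite eq_rlshift mulr0 add0r.
Qed.

Lemma msmooth_base (h : B -> R) : base_smooth h -> msmooth (fun p : M => h p.1).
Proof.
move=> sh z Bz k.
apply: (@Ck_at_coordinate_map _ _ _ _ _ k (extend0 h)).
- exact: continuous_lsubmx.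
- exact: lsubmx_coordinate_map.
- exact: (sh (SigSub (mem_set Bz)) k).
Qed.

Lemma base_smooth_slice f v : msmooth f ->
  base_smooth (fun b => f (b, dual_torus_pi v)).
Proof.
move=> sf b k.
have -> : (fun y => oapp (fun b => f (b, dual_torus_pi v)) 0 (insub y)) =
    unroll f \o (fun x => row_mx x v).
  by apply/funext => y; rewrite /unroll /= row_mxKl row_mxKr.
apply: Ck_at_coordinate_map (row_mx_coordinate_map v) _.
  move=> x; apply: (@cvg_rowP _ _ _ (nbhs x) _ (fun x => row_mx x v)) => a.
  rewrite mxE; case: split_ordP => i ->.
    under eq_fun do rewrite row_mxEl; exact: coord_continuous.
  under eq_fun do rewrite row_mxEr; exact: cvg_cst.
by apply: sf; rewrite row_mxKl; exact: setval.
Qed.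

End MirrorCalculus.

(** * Connections and gauge transformations *)

Section ComplexFacts.
Context {R : realType}.
Implicit Types z w : R[i].

Lemma conjCE (a b : R) : (Complex a b : R[i])^* = Complex a (- b).
Proof. by []. Qed.

Lemma norm1_conj z : `|z| = 1 -> z * z^* = 1.
Proof. by move=> z1; rewrite -normCK z1 expr1n. Qed.

Lemma norm1_inv z : `|z| = 1 -> z^-1 = z^*.
Proof.
move=> z1; have z0 : z != 0 by rewrite -normr_gt0 z1.
by apply: (mulfI z0); rewrite divff// norm1_conj.
Qed.

Lemma norm1_sqr (a b : R) : (`|Complex a b : R[i]| = 1) <-> a ^+ 2 + b ^+ 2 = 1.
Proof.
have H : (Complex a b : R[i]) * (Complex a b)^* = Complex (a ^+ 2 + b ^+ 2) 0.
  by rewrite conjCE; congr Complex; ring.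
split.
  by move=> /norm1_conj; rewrite H => -[].
move=> ab; apply/eqP; rewrite -sqrp_eq1// normCK H ab//.
Qed.

End ComplexFacts.

Section Connections.
Context {R : realType} {q r : nat} {B : set 'rV[R]_q}.
Context (open_B : open B).
Local Notation M := (mirror r B).
Local Notation C := R[i].
Implicit Types (s t : M -> C) (j : 'I_(q + r)) (p : M).

Lemma csmooth_conj s : csmooth s -> csmooth (fun p => (s p)^*).
Proof.
move=> [s1 s2]; split.
  rewrite (_ : (fun _ => _) = (fun p => complex.Re (s p))) //.
  by apply/funext => p; case: (s p).
rewrite (_ : (fun _ => _) = (fun p => - complex.Im (s p))); first exact: msmoothN.
by apply/funext => p; case: (s p).
Qed.

Lemma csmooth_cpartial j s : csmooth s -> csmooth (cpartial j s).
Proof. by move=> [s1 s2]; split; exact: msmooth_mpartial. Qed.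

Lemma cpartial_conj j s p : csmooth s ->
  cpartial j (fun p => (s p)^*) p = (cpartial j s p)^*.
Proof.
move=> [s1 s2]; rewrite /cpartial.
have -> : (fun p => complex.Re (s p)^*) = (fun p => complex.Re (s p)).
  by apply/funext => x; case: (s x).
have -> : (fun p => complex.Im (s p)^*) = (fun p => - complex.Im (s p)).
  by apply/funext => x; case: (s x).
by rewrite mpartialN.
Qed.

Lemma cpartialD j s t p : csmooth s -> csmooth t ->
  cpartial j (fun p => s p + t p) p = cpartial j s p + cpartial j t p.
Proof.
move=> [s1 s2] [t1 t2]; rewrite /cpartial.
have -> : (fun p => complex.Re (s p + t p)) =
    (fun p => complex.Re (s p) + complex.Re (t p)).
  by apply/funext => x; case: (s x) => ? ?; case: (t x).
have -> : (fun p => complex.Im (s p + t p)) =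
    (fun p => complex.Im (s p) + complex.Im (t p)).
  by apply/funext => x; case: (s x) => ? ?; case: (t x).
by rewrite !mpartialD.
Qed.

Lemma cpartialM j s t p : csmooth s -> csmooth t ->
  cpartial j (fun p => s p * t p) p = cpartial j s p * t p + s p * cpartial j t p.
Proof.
move=> [s1 s2] [t1 t2]; rewrite /cpartial.
have -> : (fun p => complex.Re (s p * t p)) = (fun p =>
    complex.Re (s p) * complex.Re (t p) +
    - (complex.Im (s p) * complex.Im (t p))).
  by apply/funext => x; case: (s x) => ? ?; case: (t x).
have -> : (fun p => complex.Im (s p * t p)) = (fun p =>
    complex.Re (s p) * complex.Im (t p) + complex.Im (s p) * complex.Re (t p)).
  by apply/funext => x; case: (s x) => ? ?; case: (t x).
rewrite !mpartialD ?mpartialN ?mpartialM//; do ?[exact: msmoothM|apply: msmoothN].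
case: (s p) => a b; case: (t p) => c d /=.
by congr Complex; ring.
Qed.

Lemma csmooth_imag (A : M -> R) : msmooth A -> csmooth (fun p => Complex 0 (A p)).
Proof. by move=> sA; split => //=; exact: msmooth_cst. Qed.

Lemma d_plus_hermitian (A : 'I_(q + r) -> M -> R) : (forall j, msmooth (A j)) ->
  hermitian_connection (d_plus A).
Proof.
move=> sA; split.
- move=> s j; apply: csmoothD; first exact/csmooth_cpartial/smooth_funP.
  by apply: csmoothM (smooth_funP s); exact: csmooth_imag.
- move=> s t j p; rewrite /d_plus /= cpartialD; try exact: smooth_funP.
  ring.
- move=> f s j p; rewrite /d_plus /= cpartialM; try exact: smooth_funP.
  ring.
- move=> s t j p; rewrite /d_plus.
  rewrite (cpartialM j p (smooth_funP s) (csmooth_conj (smooth_funP t))).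
  rewrite (cpartial_conj j p (smooth_funP t)).
  case: (cpartial j s p) => a b; case: (cpartial j t p) => c d.
  case: (s p : C) => e f; case: (t p : C) => g h.
  by rewrite !conjCE /=; congr Complex; ring.
Qed.

(** The constant section 1 recovers the connection form, and its smoothness. *)
Lemma smooth_conn_form (A : 'I_(q + r) -> M -> R) j :
  csmooth (d_plus A (Defs.one_fun open_B) j) -> msmooth (A j).
Proof.
case=> _; rewrite (_ : (fun _ => _) = A j) //; apply/funext => p.
by rewrite /d_plus cpartial_one add0r mulr1.
Qed.

Definition conj_fun (g : @smooth_fun R q r B) : smooth_fun :=
  SmoothFun (csmooth_conj (smooth_funP g)).

Lemma gauge_conj g : gauge g -> gauge (conj_fun g).
Proof. by move=> gg p; rewrite /= norm_conjC. Qed.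

Lemma gauge_mul (g h : @smooth_fun R q r B) : gauge g -> gauge h -> gauge (Defs.mul_fun g h).
Proof. by move=> gg gh p; rewrite /= normrM gg gh mulr1. Qed.

Lemma gauge_one : gauge (Defs.one_fun open_B : @smooth_fun R q r B).
Proof. by move=> p; rewrite /= normr1. Qed.

Lemma gauge_act_mul g h (D : @operator R q r B) :
  gauge_act h (gauge_act g D) = gauge_act (Defs.mul_fun g h) D.
Proof.
apply/funext => s; apply/funext => j; apply/funext => p; rewrite /gauge_act.
have -> : Defs.mul_fun g (Defs.mul_fun h s) = Defs.mul_fun (Defs.mul_fun g h) s.
  by apply: smooth_fun_eq => x; rewrite /= mulrA.
by rewrite /= mulrA invfM; congr (_ * _); rewrite mulrC.
Qed.

Lemma gauge_act_one (D : @operator R q r B) : gauge_act (Defs.one_fun open_B) D = D.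
Proof.
apply/funext => s; apply/funext => j; apply/funext => p; rewrite /gauge_act.
rewrite /= invr1 mul1r; congr (D _ _ _).
by apply: smooth_fun_eq => x; rewrite /= mul1r.
Qed.

Lemma gauge_class_refl (D : @operator R q r B) : gauge_class D D.
Proof. by exists (Defs.one_fun open_B); [exact: gauge_one|rewrite gauge_act_one]. Qed.

Lemma gauge_classE (D D' : @operator R q r B) : gauge_class D D' ->
  gauge_class D' = gauge_class D.
Proof.
case=> g gg ->; apply/seteqP; split=> _ [h gh ->].
  by exists (Defs.mul_fun g h); [exact: gauge_mul|rewrite gauge_act_mul].
exists (Defs.mul_fun (conj_fun g) h); first exact/gauge_mul/gh/gauge_conj.
rewrite gauge_act_mul; congr gauge_act; apply: smooth_fun_eq => x.
by rewrite /= mulrA norm1_conj// mul1r.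
Qed.

(** The real 1-form [g^-1 dg / sqrt(-1)], with [g^-1] written as the conjugate
of [g]. *)
Definition maurer_cartan (g : smooth_fun) j p : R :=
  complex.Im ((g p : C)^* * cpartial j g p).

(** Differentiating [g * g^* = 1] shows that [g^* * dg] is purely imaginary. *)
Lemma cpartial_gauge g j p : gauge g ->
  cpartial j g p = Complex 0 (maurer_cartan g j p) * g p.
Proof.
move=> gg; have sg := smooth_funP g.
have : cpartial j (fun p => g p * (g p : C)^*) p = 0.
  rewrite (_ : (fun _ => _) = fun=> 1); first exact: cpartial_cst.
  by apply/funext => x; exact: norm1_conj.
rewrite (cpartialM j p sg (csmooth_conj sg)) (cpartial_conj j p sg).
rewrite /maurer_cartan; have /norm1_conj := gg p.
case: (cpartial j g p) => a b; case: (g p : C) => c d.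
rewrite !conjCE => -[cd _] [re _]; rewrite /=.
(* [re] is the derivative of [|g|^2 / 2] and [cd] is [|g|^2 = 1]. *)
have {}re : a * c + b * d = 0 by lra.
have {}cd : c ^+ 2 + d ^+ 2 = 1 by rewrite -cd; ring.
congr Complex.
  rewrite -[LHS]mulr1 -cd mul0r sub0r.
  transitivity (c * (a * c + b * d) - (c * b + - d * a) * d); first by ring.
  by rewrite re; ring.
rewrite -[LHS]mulr1 -cd mul0r add0r.
transitivity (d * (a * c + b * d) + (c * b + - d * a) * c); first by ring.
by rewrite re; ring.
Qed.

Lemma gauge_act_d_plus g A : gauge g ->
  gauge_act g (d_plus A) = d_plus (fun j p => A j p + maurer_cartan g j p).
Proof.
move=> gg; apply/funext => s; apply/funext => j; apply/funext => p.
rewrite /gauge_act /d_plus /= cpartialM; try exact: smooth_funP.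
rewrite (cpartial_gauge j p gg).
have g0 : (g p : C) != 0 by rewrite -normr_gt0 gg.
have -> : Complex 0 (A j p + maurer_cartan g j p) =
    Complex 0 (A j p) + Complex 0 (maurer_cartan g j p) :> C.
  by congr Complex; rewrite addr0.
by field.
Qed.

Lemma gauge_act_smooth g (D : @operator R q r B) (s : smooth_fun) j : gauge g ->
  hermitian_connection D -> csmooth (gauge_act g D s j).
Proof.
move=> gg hD.
rewrite (_ : gauge_act g D s j = (fun p => (g p : C)^* * D (Defs.mul_fun g s) j p)).
  by apply: csmoothM; [exact/csmooth_conj/smooth_funP|exact: (conn_smooth hD)].
by apply/funext => p; rewrite /gauge_act norm1_inv.
Qed.

End Connections.

(** * Trigonometric functions: integrality and smoothness *)

Section Trig.
Context {R : realType}.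
Implicit Types (a c s : R) (n : int).

Lemma cosD2piz a n : cos (a + 2 * pi * n%:~R) = cos a.
Proof.
rewrite mulr_natl; case: n => n; first by rewrite mulr_natr; exact/periodicn/cosD2pi.
rewrite NegzE mulrN mulr_natr -[LHS](periodicn (@cosD2pi R) n.+1).
by rewrite subrK.
Qed.

Lemma sinD2piz a n : sin (a + 2 * pi * n%:~R) = sin a.
Proof.
rewrite mulr_natl; case: n => n; first by rewrite mulr_natr; exact/periodicn/sinD2pi.
rewrite NegzE mulrN mulr_natr -[LHS](periodicn (@sinD2pi R) n.+1).
by rewrite subrK.
Qed.

(** Reduce [c] modulo [2 pi] to [d] in [0, 2 pi[; then [sin (d / 2)] vanishes by
the half-angle formula, although it is positive on ]0, pi[. *)
Lemma cos_eq1_2piz c : cos c = 1 -> exists n, c = 2 * pi * n%:~R.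
Proof.
move=> c1; have p0 := @pi_gt0 R; have p20 : 0 < 2 * pi :> R by rewrite mulr_gt0.
pose n := Num.floor (c / (2 * pi)); exists n.
pose d := c - 2 * pi * n%:~R.
have d0 : 0 <= d by rewrite subr_ge0 mulrC -ler_pdivlMr// ge_floor.
have d2 : d < 2 * pi.
  rewrite ltrBlDr -[X in _ < X + _]mulr1 -mulrDr [ltRHS]mulrC -ltr_pdivrMr//.
  by rewrite addrC -[1]/(1%:~R) -intrD floorD1_gt.
have cd : cos d = 1.
  by rewrite -(cosD2piz d n) /d subrK.
apply/eqP; rewrite -subr_eq0 -/d; apply/negPn/negP => dn0.
have : 0 < sin (d / 2).
  have dp : 0 < d by rewrite lt0r dn0 d0.
  by apply: sin_gt0_pi; apply/andP; split; lra.
have : sin (d / 2) ^+ 2 = 0.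
  have := cosD (d / 2) (d / 2); rewrite -splitr cd.
  have := cos2Dsin2 (d / 2); lra.
by move/eqP; rewrite sqrf_eq0 => /eqP ->; rewrite ltxx.
Qed.

(** [P + sqrt(-1) Q] solves [z' = sqrt(-1) c z], so its product with
[exp (- sqrt(-1) c s)], whose real and imaginary parts are [X] and [Y] below, is
constant.  Comparing the values at 0 and 1 gives [exp (sqrt(-1) c) = 1]. *)
Lemma winding_number (P Q : R -> R) c :
  (forall s, is_derive s 1 P (- (c * Q s))) -> (forall s, is_derive s 1 Q (c * P s)) ->
  P 1 = P 0 -> Q 1 = Q 0 -> P 0 ^+ 2 + Q 0 ^+ 2 = 1 ->
  exists n, c = 2 * pi * n%:~R.
Proof.
move=> dP dQ P1 Q1 PQ; apply: cos_eq1_2piz.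
have dc s : is_derive s 1 (fun s => cos (c * s)) (- (c * sin (c * s))).
  by apply: trigger_derive; rewrite /GRing.scale /=; ring.
have ds s : is_derive s 1 (fun s => sin (c * s)) (c * cos (c * s)).
  by apply: trigger_derive; rewrite /GRing.scale /=; ring.
pose X s := P s * cos (c * s) + Q s * sin (c * s).
pose Y s := Q s * cos (c * s) - P s * sin (c * s).
have E1 : X 1 = X 0.
  apply: (@is_derive_0_is_cst _ X) => s.
  by apply: trigger_derive; rewrite /GRing.scale /=; ring.
have E2 : Y 1 = Y 0.
  apply: (@is_derive_0_is_cst _ Y) => s.
  by apply: trigger_derive; rewrite /GRing.scale /=; ring.
move: E1 E2; rewrite /X /Y !mulr1 !mulr0 cos0 sin0 P1 Q1.
move: (P 0) (Q 0) PQ => p q pq E1 E2.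
transitivity (p * (p * cos c + q * sin c) + q * (q * cos c - p * sin c)).
  by rewrite -[LHS]mul1r -pq; ring.
by rewrite E1 E2 !mulr1 !mulr0 addr0 subr0 -!expr2.
Qed.

End Trig.

Section LineDerivative.
Context {R : realType} {n : nat}.
Implicit Types (F : 'rV[R]_n -> R) (z v : 'rV[R]_n).

(** As the difference quotients coincide, a directional derivative and the
corresponding derivative in one variable exist together and are equal. *)
Let quotient_line F z v (s : R) :
  (fun h : R => h^-1 *: ((F \o shift (s *: v + z)) (h *: v) - F (s *: v + z))) =
  (fun h : R => h^-1 *: (((fun s => F (s *: v + z)) \o shift s) (h *: (1 : R)) -
    (fun s => F (s *: v + z)) s)).
Proof.
apply/funext => h /=; congr (_ *: (F _ - _)).
by rewrite addrA -scalerDl /GRing.scale /= mulr1.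
Qed.

Lemma derive_line F z v s :
  'D_v F (s *: v + z) = 'D_1 (fun s : R => F (s *: v + z)) s.
Proof. by rewrite /derive quotient_line. Qed.

Lemma derivable_line F z v s :
  derivable F (s *: v + z) v = derivable (fun s : R => F (s *: v + z)) s 1.
Proof. by rewrite /derivable quotient_line. Qed.

Definition lin_form (c z : 'rV[R]_n) : R := \sum_j c 0 j * z 0 j.

Lemma lin_formD c z w : lin_form c (z + w) = lin_form c z + lin_form c w.
Proof.
by rewrite /lin_form -big_split; apply: eq_bigr => j _; rewrite mxE mulrDr.
Qed.

Lemma lin_form_delta c j (h : R) z :
  lin_form c (h *: delta_mx 0 j + z) = c 0 j * h + lin_form c z.
Proof.
rewrite lin_formD; congr (_ + _); rewrite /lin_form (bigD1 j)//= !mxE !eqxx mulr1.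
rewrite big1 ?addr0// => i /negPf ij; by rewrite !mxE ij andbF !mulr0.
Qed.

Lemma lin_form_continuous c : continuous (lin_form c).
Proof.
have H (X : Type) (F : set_system X) (FF : Filter F) (f : X -> 'rV[R]_n) z :
    f x @[x --> F] --> z -> lin_form c (f x) @[x --> F] --> lin_form c z.
  move=> fz; apply: cvg_big => [|j _]; first exact: add_continuous.
  by apply: cvgMl_tmp; exact: cvg_coord.
by move=> z; exact: (H _ (nbhs z) _ id).
Qed.

Lemma is_derive_cos_lin c j z :
  is_derive z (delta_mx 0 j) (fun z => cos (lin_form c z)) (- c 0 j * sin (lin_form c z)).
Proof.
have : is_derive (0 : R) 1 (fun s : R => cos (lin_form c (s *: delta_mx 0 j + z)))
    (- c 0 j * sin (lin_form c z)).
  under eq_fun do rewrite lin_form_delta.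
  by apply: trigger_derive; rewrite /GRing.scale /= mulr0 add0r; ring.
case=> dv; rewrite -(derive_line (fun z => cos (lin_form c z)) z) scale0r add0r => <-.
split; last by [].
by rewrite -(derivable_line (fun z => cos (lin_form c z)) z) scale0r add0r in dv.
Qed.

Lemma is_derive_sin_lin c j z :
  is_derive z (delta_mx 0 j) (fun z => sin (lin_form c z)) (c 0 j * cos (lin_form c z)).
Proof.
have : is_derive (0 : R) 1 (fun s : R => sin (lin_form c (s *: delta_mx 0 j + z)))
    (c 0 j * cos (lin_form c z)).
  under eq_fun do rewrite lin_form_delta.
  by apply: trigger_derive; rewrite /GRing.scale /= mulr0 add0r; ring.
case=> dv; rewrite -(derive_line (fun z => sin (lin_form c z)) z) scale0r add0r => <-.
split; last by [].
by rewrite -(derivable_line (fun z => sin (lin_form c z)) z) scale0r add0r in dv.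
Qed.

Lemma Ck_at_trig k c z :
  Ck_at k (fun z => cos (lin_form c z)) z /\ Ck_at k (fun z => sin (lin_form c z)) z.
Proof.
have cc y : {for y, continuous (fun z => cos (lin_form c z))}.
  by apply: continuous_comp; [exact: lin_form_continuous|exact: continuous_cos].
have cs y : {for y, continuous (fun z => sin (lin_form c z))}.
  by apply: continuous_comp; [exact: lin_form_continuous|exact: continuous_sin].
elim: k => [|k [IHc IHs]] /=; first by do 2!split=> //; apply: (@nearW _ (nbhs z)).
split; (split; first exact: (@nearW _ (nbhs z))); split=> j.
- apply: (@nearW _ (nbhs z)) => y; by have [] := is_derive_cos_lin c j y.
- rewrite (_ : pderiv j _ = cst (- c 0 j) \* (fun z => sin (lin_form c z))).
    by apply: Ck_atM; [exact: Ck_at_cst|].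
  by apply/funext => y; rewrite /pderiv; have := is_derive_cos_lin c j y; case.
- apply: (@nearW _ (nbhs z)) => y; by have [] := is_derive_sin_lin c j y.
- rewrite (_ : pderiv j _ = cst (c 0 j) \* (fun z => cos (lin_form c z))).
    by apply: Ck_atM; [exact: Ck_at_cst|].
  by apply/funext => y; rewrite /pderiv; have := is_derive_sin_lin c j y; case.
Qed.

End LineDerivative.

(** * Characters of the dual torus as gauge transformations *)

Section CharacterGauge.
Context {R : realType} {q r : nat} {B : set 'rV[R]_q}.
Context (open_B : open B).
Local Notation M := (mirror r B).

Lemma eq_mpartial j (f : M -> R) F b v :
  (forall z, B (lsubmx z) -> unroll f z = F z) ->
  mpartial j f (b, dual_torus_pi v) = pderiv j F (row_mx (val b) v).
Proof.
move=> fF; rewrite mpartialE.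
have Bz : B (lsubmx (row_mx (val b) v)) by rewrite row_mxKl; exact: setval.
have eqF : \forall w \near row_mx (val b) v, unroll f w = F w.
  by move: (near_lsubmx open_B Bz); apply: filterS => w /fF.
exact: nbhs_singleton (near_eq_pderiv j eqF).
Qed.

Context (m : 'rV[int]_r).

Definition char_coef : 'rV[R]_(q + r) := row_mx 0 ((2 * pi) *: map_mx intr m).

(** The choice of a representative matters only modulo [2 pi Z]
([char_angle_pi]), so the cosine and sine of the angle are smooth even where
the angle itself jumps. *)
Definition char_angle (p : M) : R :=
  lin_form ((2 * pi) *: map_mx intr m) (repr p.2).

Definition char_val (p : M) : R[i] :=
  Complex (cos (char_angle p)) (sin (char_angle p)).

Lemma lin_form_char_coef z : lin_form char_coef z =
  lin_form ((2 * pi) *: map_mx intr m) (rsubmx z).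
Proof.
rewrite /lin_form big_split_ord /= big1 ?add0r => [|i _].
  by apply: eq_bigr => i _; rewrite row_mxEr; congr (_ * _); rewrite mxE.
by rewrite row_mxEl mxE mul0r.
Qed.

Lemma char_angle_pi b v : exists n : int, char_angle (b, dual_torus_pi v) =
  lin_form ((2 * pi) *: map_mx intr m) v + 2 * pi * n%:~R.
Proof.
rewrite /char_angle /=.
have /dual_torus_pi_eqP[k ->] := dual_torus_reprK (dual_torus_pi v).
exists (\sum_j m 0 j * k 0 j); rewrite lin_formD; congr (_ + _).
rewrite rmorph_sum/= mulr_sumr; apply: eq_bigr => j _.
by rewrite !mxE intrM mulrA.
Qed.

Lemma unroll_char_cos z : B (lsubmx z) ->
  unroll (fun p => complex.Re (char_val p)) z = cos (lin_form char_coef z).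
Proof.
move=> Bz; rewrite unroll_in lin_form_char_coef /=.
by have [n ->] := char_angle_pi (SigSub (mem_set Bz)) (rsubmx z); rewrite cosD2piz.
Qed.

Lemma unroll_char_sin z : B (lsubmx z) ->
  unroll (fun p => complex.Im (char_val p)) z = sin (lin_form char_coef z).
Proof.
move=> Bz; rewrite unroll_in lin_form_char_coef /=.
by have [n ->] := char_angle_pi (SigSub (mem_set Bz)) (rsubmx z); rewrite sinD2piz.
Qed.

Lemma csmooth_char : csmooth char_val.
Proof.
split.
  by apply: (near_eq_msmooth open_B unroll_char_cos) => z _ k;
    have [] := Ck_at_trig k char_coef z.
by apply: (near_eq_msmooth open_B unroll_char_sin) => z _ k;
  have [] := Ck_at_trig k char_coef z.
Qed.

Definition char_fun : smooth_fun := SmoothFun csmooth_char.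

Lemma gauge_char : gauge char_fun.
Proof. by move=> p; apply/norm1_sqr; exact: cos2Dsin2. Qed.

Lemma maurer_cartan_char j p : maurer_cartan char_fun j p = char_coef 0 j.
Proof.
case: p => b t; rewrite /maurer_cartan /cpartial -[t]dual_torus_reprK.
rewrite (eq_mpartial j b (repr t) unroll_char_cos).
rewrite (eq_mpartial j b (repr t) unroll_char_sin).
rewrite /pderiv; have [_ ->] := is_derive_cos_lin char_coef j (row_mx (val b) (repr t)).
have [_ ->] := is_derive_sin_lin char_coef j (row_mx (val b) (repr t)).
rewrite dual_torus_reprK lin_form_char_coef row_mxKr /= /char_val /=.
rewrite /char_angle /=; set a := lin_form _ _.
rewrite -[RHS]mulr1 -(cos2Dsin2 a); ring.
Qed.

End CharacterGauge.

(** * Integrality of the connection form along the circles of the dual torus *)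

Section Holonomy.
Context {R : realType} {q r : nat} {B : set 'rV[R]_q}.
Context (open_B : open B).

Lemma row_mx_line (x : 'rV[R]_q) (a : 'I_r) (s : R) :
  s *: delta_mx 0 (rshift q a) + row_mx x 0 = row_mx x (s *: delta_mx 0 a).
Proof.
apply/rowP => k; rewrite !mxE; case: split_ordP => i ->.
  by rewrite eq_lrshift mulr0 add0r.
by rewrite !mxE (inj_eq (@rshift_inj _ _)) addr0.
Qed.

Lemma row_mx_period (x : 'rV[R]_q) (a : 'I_r) :
  row_mx x (1 *: delta_mx 0 a) =
  row_mx x (0 *: delta_mx 0 a) + row_mx 0 (map_mx intr (delta_mx 0 a)).
Proof. by rewrite add_row_mx addr0 scale1r scale0r add0r map_delta_mx. Qed.

(** On a [y^a]-circle over [b], the function [g] satisfies the equation of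
[winding_number], and [c] is [2 pi] times the degree of [g] on that circle. *)
Lemma maurer_cartan_integral (g : @smooth_fun R q r B) (a : 'I_r) (b : B) (c : R) :
  gauge g -> (forall t, maurer_cartan g (rshift q a) (b, t) = c) ->
  exists n : int, c = 2 * pi * n%:~R.
Proof.
move=> gg gc; have [sP sQ] := smooth_funP g.
set j := rshift q a in gc *; pose l s : 'rV[R]_(q + r) := s *: delta_mx 0 j + row_mx (val b) 0.
have lE (s : R) : l s = row_mx (val b) (s *: delta_mx 0 a) by rewrite /l row_mx_line.
pose G s := g (b, dual_torus_pi (s *: delta_mx 0 a)).
have dl (f : mirror r B -> R) (s : R) : msmooth f -> is_derive s 1 (fun s : R => unroll f (l s))
    (mpartial j f (b, dual_torus_pi (s *: delta_mx 0 a))).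
  move=> sf; rewrite mpartialE -lE /pderiv derive_line; apply: derivableP.
  rewrite -derivable_line; apply/smooth_at_derivable/sf.
  by rewrite -/(l s) lE row_mxKl; exact: setval.
have dg (s : R) : cpartial j g (b, dual_torus_pi (s *: delta_mx 0 a)) = Complex 0 c * G s.
  by rewrite (cpartial_gauge open_B)// gc.
have fE (f : mirror r B -> R) s :
    unroll f (l s) = f (b, dual_torus_pi (s *: delta_mx 0 a)).
  by rewrite lE unrollE.
have per (f : mirror r B -> R) : unroll f (l 1) = unroll f (l 0).
  by rewrite !lE row_mx_period unroll_periodic.
apply: (@winding_number R (fun s => unroll (fun p => complex.Re (g p)) (l s))
                          (fun s => unroll (fun p => complex.Im (g p)) (l s))).
- move=> s; have := dl _ s sP; have := dg s; rewrite /cpartial fE -/(G s).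
  by case: (G s) => x y [-> _]; rewrite mul0r sub0r.
- move=> s; have := dl _ s sQ; have := dg s; rewrite /cpartial fE -/(G s).
  by case: (G s) => x y [_ ->]; rewrite mul0r add0r.
- exact: per.
- exact: per.
- rewrite !fE -/(G 0); have := gg (b, dual_torus_pi (0 *: delta_mx 0 a)); rewrite -/(G 0).
  by case: (G 0) => x y /norm1_sqr.
Qed.

End Holonomy.

(** * Real Fourier-Mukai transforms *)

Section FourierMukai.
Context {R : realType} {q r : nat} {B : set 'rV[R]_q}.
Context (open_B : open B) (contractible_B : contractible_set B).
Implicit Types (u : B -> torus R r) (f : B -> 'rV[R]_r).

Lemma lift_ofP u : torus_smooth u -> is_lift u (lift_of u).
Proof.
move=> /(smooth_lift_exists open_B contractible_B) ex_lift.
exact: (@xgetPex _ _ [set f | is_lift u f] ex_lift).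
Qed.

Lemma torus_smooth_pi f : (forall a, base_smooth (fun x => f x 0 a)) ->
  torus_smooth (fun b => torus_pi (f b)).
Proof.
move=> sf x; exists (extend0 f).
have := near_open open_B (setval x); apply: filterS => y By; split=> [a|b <-].
  apply: near_eq_smooth_at (sf a (SigSub (mem_set By))).
  apply: (@nearW _ (nbhs y)) => z; rewrite /extend0.
  by case: insub => //=; rewrite mxE.
by rewrite extend0E.
Qed.

Lemma nabla_hermitian f : (forall a, base_smooth (fun x => f x 0 a)) ->
  hermitian_connection (nabla f).
Proof.
move=> sf; apply: (d_plus_hermitian open_B) => j; case: (fintype.split j) => i.
  exact: msmooth_cst.
exact: (msmooth_base (sf i)).
Qed.

Lemma nabla_torus_act f t : torus_act t (nabla f) = nabla f.
Proof. by rewrite /nabla torus_act_d_plus. Qed.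

Lemma nabla_partial_B f : partial_B (nabla f) = d_B.
Proof.
apply/funext => s; apply/funext => i; apply/funext => p.
rewrite /partial_B /nabla /d_plus (unsplitK (inl i)).
by rewrite (_ : Complex 0 0 = 0) // mul0r addr0.
Qed.

(** At [x], the connection form of the gauge transformation has the components
of [g x - f x], which do not depend on the point of the dual torus. *)
Lemma gauge_class_nabla_inj f g :
  gauge_class (nabla f) (nabla g) -> forall x, torus_pi (f x) = torus_pi (g x).
Proof.
move=> [h gh]; rewrite /nabla gauge_act_d_plus// => /(d_plus_inj open_B) E x.
have H a : exists n : int, g x 0 a - f x 0 a = 2 * pi * n%:~R.
  apply: (maurer_cartan_integral open_B gh (a := a) (b := x)) => t.
  have /(congr1 (fun A => A (rshift q a) (x, t))) := E.
  by rewrite (unsplitK (inr a)) /= => ->; rewrite addrAC subrr add0r.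
have [m fg] := fin_all_exists H.
apply/esym/torus_pi_eqP; exists (\row_a m a); apply/rowP => a.
by rewrite !mxE -fg addrC subrK.
Qed.

Lemma gauge_class_nabla f g (m : 'rV[int]_r) :
  (forall x, g x = f x + (2 * pi) *: map_mx intr m) ->
  gauge_class (nabla f) (nabla g).
Proof.
move=> gf; exists (char_fun open_B m); first exact: gauge_char.
rewrite /nabla gauge_act_d_plus//; last exact: gauge_char.
congr d_plus; apply/funext => j; apply/funext => p.
rewrite maurer_cartan_char /char_coef; case: split_ordP => i ->.
  by rewrite row_mxEl mxE addr0.
by rewrite row_mxEr gf !mxE.
Qed.

(** A connection form that is constant along the dual torus and has no [dx^i]
component is determined by its values on the section [y = 0], which serve as
the components of [f]. *)
Lemma invariant_nabla (D : @operator R q r B) :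
  (exists A : 'I_(q + r) -> mirror r B -> R, D = d_plus A) ->
  (forall s j, csmooth (D s j)) ->
  (forall t, torus_act t D = D) -> partial_B D = d_B ->
  exists2 f : B -> 'rV[R]_r, (forall a, base_smooth (fun x => f x 0 a)) & D = nabla f.
Proof.
move=> [A ->] sD invD dD.
have sA j : msmooth (A j) by exact: smooth_conn_form (sD (Defs.one_fun open_B) j).
have invA j b t : A j (b, t) = A j (b, dual_torus_pi 0).
  have := invD t; rewrite torus_act_d_plus// => /(d_plus_inj open_B).
  move=> /(congr1 (fun A => A j (b, dual_torus_pi 0))) /=.
  by rewrite dual_torus_pi0 add0r.
have A0 i p : A (lshift r i) p = 0.
  have := congr1 (fun D => D (Defs.one_fun open_B) i p) dD.
  rewrite /partial_B /d_B /d_plus cpartial_one add0r mulr1.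
  by case.
exists (fun b => \row_a A (rshift q a) (b, dual_torus_pi 0)).
  move=> a; have := base_smooth_slice 0 (sA (rshift q a)).
  rewrite (_ : (fun _ => _) = (fun x => (\row_a A (rshift q a) (x, dual_torus_pi 0)) 0 a)) //.
  by apply/funext => x; rewrite mxE.
congr d_plus; apply/funext => j; apply/funext => -[b t].
by case: split_ordP => i ->; rewrite ?A0// mxE invA.
Qed.

End FourierMukai.

Theorem proposition6p2 (R : realType) (q r : nat) (B : set 'rV[R]_q)
    (open_B : open B) (contractible_B : contractible_set B) :
  set_inj (graphical r B) fourier_mukai /\
  fourier_mukai @` graphical r B =
    [set c | moduli r B c /\
       exists2 D : operator, c D &
         (forall t : dual_torus R r, torus_act t D = D) /\
         partial_B D = d_B].
Proof.
split.
  move=> _ _ /set_mem[u su <-] /set_mem[v sv <-]; rewrite !fourier_mukai_graph => E.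
  congr graph; apply/funext => x.
  have [_ <-] := lift_ofP open_B contractible_B su.
  have [_ <-] := lift_ofP open_B contractible_B sv.
  by apply: (gauge_class_nabla_inj open_B); rewrite E; exact: gauge_class_refl.
apply/seteqP; split=> [_ [_ [u su <-] <-]|_ [[D0 hD0 <-] [D [g gg DE] [invD dD]]]].
  have [su' _] := lift_ofP open_B contractible_B su.
  rewrite fourier_mukai_graph; split.
    by exists (nabla (lift_of u)) => //; exact: nabla_hermitian.
  exists (nabla (lift_of u)); first exact: gauge_class_refl.
  by split=> [t|]; [exact: nabla_torus_act|exact: nabla_partial_B].
have [||f sf Df] := invariant_nabla open_B _ _ invD dD.
- have [A D0E] := hermitian_connectionE open_B hD0.
  by eexists; rewrite DE D0E gauge_act_d_plus.
- by move=> s j; rewrite DE; exact: gauge_act_smooth.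
pose u b := torus_pi (f b).
have su : torus_smooth u by exact: torus_smooth_pi.
exists (graph u); first by exists u.
have fu : is_lift u f by [].
(* The chosen lift of [u] need not be [f], but it has a gauge equivalent
   transform. *)
have [m fm] := lift_unique contractible_B (lift_ofP open_B contractible_B su) fu.
rewrite fourier_mukai_graph (gauge_classE (gauge_class_nabla open_B fm)) -Df.
by apply: gauge_classE; exists g.
Qed.
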